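(* Let the rows of $X_n$ be sampled i.i.d. from a $p$-dimensional distribution having finite fourth cumulant, with positive definite $p\times p$ covariance matrix $\Sigma$, and let $\lambda_i^*=\lambda_i(\Sigma)$ for $i\in[p]$. Suppose that the conditions (C) of the context hold. If in addition $m\cdot\big(n\tau_{m,n}(G_n)_{(ii),(ii)}\big)^{-1}\to0$, then for any $i\in[p]$, $$\sqrt{\frac{m}{\tau_{m,n}(G_n)_{(ii),(ii)}}}\;\hat\Lambda_{m,n,i}^{-1}(\hat\Lambda_{m,n,i}-\lambda_i^* )\Rightarrow\mathcal N(0,1).$$
   Context: Asymptotic regime: $p$ fixed, $n\to\infty$, $m=m_n\to\infty$, $m<n$. $\lambda_i(\cdot)$ is the $i$-th largest eigenvalue; $\hat\Lambda_{m,n,i}=\lambda_i(X_n^\top S_{m,n}^\top S_{m,n}X_n)$, with $S_{m,n}$ a random $m\times n$ sketching matrix drawn independently of the data. $X_n$ is $n\times p$ with SVD $X_n=U_nL_nV_n^\top$, $U_n$ being $n\times p$ with orthonormal columns, $L_n=\mathrm{diag}(\ell_{n,1},\dots,\ell_{n,p})$ with $\ell_{n,1}\ge\dots\ge\ell_{n,p}>0$, $V_n$ orthogonal. Conditions (C) (understood conditionally on the data $(X_n)_{n\ge1}$): $\limsup_n\ell_{n,1}/\ell_{n,p}<\infty$ and $\liminf_n\min_{i\in[p-1]}\ell_{n,i}/\ell_{n,i+1}>1$; $\tau_{m,n}>0$, $\tau_{m,n}/m\to0$; $(U_n)_{n\ge1}$ satisfies a condition $\mathfrak P'$ (specified for each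 sketching distribution) under which there are absolutely symmetric $p^2\times p^2$ matrices $G_n$ and constants $0<c_0<C_0<\infty$ with $c_0I_{p(p+1)/2}\preceq D_p^\top G_nD_p\preceq C_0I_{p(p+1)/2}$ and $\sqrt m(\tau_{m,n}D_p^\top G_nD_p)^{-1/2}D_p^\top\mathrm{vec}(U_n^\top S_{m,n}^\top S_{m,n}U_n-I_p)\Rightarrow\mathcal N(0,I_{p(p+1)/2})$. Here $\mathrm{vec}$ stacks columns, with indexing $\mathrm{vec}(A)_{(ij)}=A_{ij}$; $D_p$ is the $p^2\times p(p+1)/2$ matrix $(D_p)_{(ij),(kl)}=\delta_{ik}\delta_{jl}$, $k\le l$; a positive semidefinite $p^2\times p^2$ matrix $G$ is absolutely symmetric if $G_{(ij),(kl)}=G_{(ij),(lk)}=G_{(ji),(kl)}=G_{(ji),(lk)}$ for all indices and $D_p^\top GD_p$ is positive definite.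
   Formalization: The data matrix is taken as X_n = n^{-1/2} Z_n with the rows of Z_n (not of X_n) sampled i.i.d. from the distribution, and the distribution is assumed to have mean zero; without these the claim is false. *)

(* Defs.v *)
From HB Require Import structures.
From mathcomp Require Import all_boot all_order all_algebra.
From mathcomp Require Import all_classical all_reals all_analysis.

Set Implicit Arguments.
Unset Strict Implicit.
Unset Printing Implicit Defensive.

Import Order.TTheory GRing.Theory Num.Theory.
Import numFieldNormedType.Exports.

Local Open Scope classical_set_scope.
Local Open Scope ring_scope.

Section RealMatrices.
Context {R : realType}.

Definition psdmx n (A : 'M[R]_n) : Prop :=
  A^T = A /\ forall x : 'cV[R]_n, 0 <= (x^T *m A *m x) 0 0.

Definition posdefmx n (A : 'M[R]_n) : Prop :=
  A^T = A /\ forall x : 'cV[R]_n, x != 0 -> 0 < (x^T *m A *m x) 0 0.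

Definition loewner_le n (A B : 'M[R]_n) : Prop := psdmx (B - A).

(* The eigenvalues of [A], repeated according to algebraic multiplicity and
   listed in nonincreasing order; junk (all zeros) when the characteristic
   polynomial does not split over R, which never happens for symmetric [A]. *)
Definition eigvals n (A : 'M[R]_n) : n.-tuple R :=
  xget [tuple of nseq n 0]
    [set s : n.-tuple R | sorted >=%R s /\
       char_poly A = \prod_(x <- s) ('X - x%:P)].

(* Indices start at 0, so [lambda A i] is the (i+1)-th largest eigenvalue. *)
Definition lambda n (A : 'M[R]_n) (i : 'I_n) : R := tnth (eigvals A) i.

(* For positive definite [A], the set below is the singleton A^{-1/2}. *)
Definition invsqrtmx n (A : 'M[R]_n) : 'M[R]_n :=
  xget 0 [set B | posdefmx B /\ B *m B = invmx A].

(* Thin singular value decomposition with positive singular values [l]. *)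
Definition is_svd n p (X U : 'M[R]_(n, p)) (l : 'rV[R]_p) (V : 'M[R]_p) : Prop :=
  [/\ X = U *m diag_mx l *m V^T,
      U^T *m U = 1%:M,
      V^T *m V = 1%:M,
      forall i j : 'I_p, (i <= j)%N -> l 0 j <= l 0 i &
      forall i, 0 < l 0 i].

Definition sketched_eigval m n p (S : 'M[R]_(m, n)) (X : 'M[R]_(n, p))
    (i : 'I_p) : R :=
  lambda (X^T *m S^T *m S *m X) i.

End RealMatrices.

Section Vectorization.
Context {R : realType}.

(* Position of the (i, j) entry in the column-stacking vec; [mxvec] stacks
   rows, hence the transpositions. *)
Definition vec_index p (i j : 'I_p) : 'I_(p * p) := mxvec_index j i.

Definition vec p (A : 'M[R]_p) : 'cV[R]_(p * p) := (mxvec A^T)^T.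

Lemma vecE p (A : 'M[R]_p) (i j : 'I_p) : vec A (vec_index i j) 0 = A i j.
Proof. by rewrite mxE mxvecE mxE. Qed.

Definition upper_pairs p : {set 'I_p * 'I_p} :=
  [set kl : 'I_p * 'I_p | (kl.1 <= kl.2)%N].

(* p (p + 1) / 2 coordinates, one for each pair k <= l. *)
Definition hdim p : nat := #|upper_pairs p|.

Lemma hdimE p : hdim p = (p * p.+1)./2.
Proof.
rewrite /hdim /upper_pairs -sum1_card.
rewrite (eq_bigl (fun kl : 'I_p * 'I_p => (kl.1 <= kl.2)%N)); last first.
  by move=> kl; rewrite inE.
rewrite -(pair_big_dep xpredT (fun k l : 'I_p => (k <= l)%N) (fun _ _ => 1%N)) /=.
rewrite (eq_bigr (fun k : 'I_p => (p - k)%N)); last first.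
  move=> k _; rewrite -(big_mkord (fun l => (k <= l)%N) (fun=> 1%N)).
  rewrite (big_cat_nat (n := k)) ?(ltnW (ltn_ord k)) //= big_nat_cond big_pred0 => [|l].
    rewrite add0n big_nat_cond (eq_bigl (fun l => (k <= l < p)%N)) => [|l].
      by rewrite -big_nat sum_nat_const_nat muln1.
    by case: (k <= l)%N; rewrite ?andbF ?andbT.
  by rewrite andbC ltnNge leq0n /= andbN.
rewrite -(big_mkord xpredT (fun k => (p - k)%N)).
rewrite mulnC -[p in (_ * p)%N]/(p.+1.-1) -bin2 -bin2_sum big_nat_rev /=.
rewrite [RHS]big_nat_recl // add0n !add0n.
by apply: eq_big_nat => k /andP[_ kp]; rewrite subKn.
Qed.

Definition dup_mx p : 'M[R]_(p * p, hdim p) :=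
  \matrix_(a, b) (a == vec_index (enum_val b).1 (enum_val b).2)%:R.

Lemma dup_mxE p (i j : 'I_p) (b : 'I_(hdim p)) :
  dup_mx p (vec_index i j) b =
    (i == (enum_val b).1)%:R * (j == (enum_val b).2)%:R.
Proof.
rewrite mxE -natrM mulnb; congr (nat_of_bool _)%:R.
apply/eqP/andP => [eq_ab|[/eqP <- /eqP <-]//].
have := vecE (\matrix_(k, l) ((k == i) && (l == j))%:R : 'M[R]_p).
move=> /[dup] /(_ i j) + /(_ (enum_val b).1 (enum_val b).2).
rewrite -eq_ab => ->; rewrite !mxE !eqxx [_ == i]eq_sym [_ == j]eq_sym.
by case: (i == _); case: (j == _) => //= /eqP; rewrite oner_eq0.
Qed.

(* D_p^T G D_p *)
Definition compress p (G : 'M[R]_(p * p)) : 'M[R]_(hdim p) :=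
  (dup_mx p)^T *m G *m dup_mx p.

Definition absolutely_symmetric p (G : 'M[R]_(p * p)) : Prop :=
  [/\ psdmx G,
      forall i j k l : 'I_p,
        [/\ G (vec_index i j) (vec_index k l) = G (vec_index i j) (vec_index l k),
            G (vec_index i j) (vec_index k l) = G (vec_index j i) (vec_index k l) &
            G (vec_index i j) (vec_index k l) = G (vec_index j i) (vec_index l k)] &
      posdefmx (compress G)].

End Vectorization.

Section Probability.
Context {R : realType}.

(* Weak convergence: the Y_n, on the probability space (T, P), converge in
   distribution to the law of Z, on the probability space (T', Q). *)
Definition cvg_in_law d (T : measurableType d) (P : probability T R)
    d' (T' : measurableType d') (Q : probability T' R) (E : topologicalType)
    (Y : nat -> T -> E) (Z : T' -> E) : Prop :=
  forall f : E -> R, continuous f -> (exists M, forall x, `|f x| <= M) ->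
    ('E_P[f \o Y n] @[n --> \oo] --> 'E_Q[f \o Z])%E.

Definition tuple_cons n (x : measurableTypeR R * n.-tuple R) : n.+1.-tuple R :=
  [tuple of (x.1 : R) :: x.2].

Lemma measurable_tuple_cons n : measurable_fun setT (@tuple_cons n).
Proof.
apply: measurable_cons; last exact: measurable_snd.
exact: (@measurable_fst _ _ (measurableTypeR R)).
Qed.

HB.instance Definition _ n := isMeasurableFun.Build _ _ _ _
  (@tuple_cons n) (@measurable_tuple_cons n).

(* The law N(0, I_n). *)
Fixpoint std_normal n : probability (n.-tuple R) R :=
  if n is n'.+1 then
    distribution (normal_prob 0 1 \x std_normal n')%E (@tuple_cons n')
  else dirac [tuple].

Definition col_of_tuple n (t : n.-tuple R) : 'cV[R]_n := \col_i tnth t i.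

Definition row_tuple n p (A : 'M[R]_(n, p)) (i : 'I_n) : p.-tuple R :=
  [tuple A i j | j < p].

Definition random_matrix d (T : measurableType d) n p (A : T -> 'M[R]_(n, p)) :=
  forall i j, measurable_fun setT (fun w => A w i j).

(* The rows of Z are mutually independent with common law mu. *)
Definition iid_rows d (T : measurableType d) (P : probability T R) p
    (mu : probability (p.-tuple R) R) n (Z : T -> 'M[R]_(n, p)) : Prop :=
  [/\ random_matrix Z,
      forall i (A : set (p.-tuple R)), measurable A ->
        P [set w | A (row_tuple (Z w) i)] = mu A &
      forall A : 'I_n -> set (p.-tuple R), (forall i, measurable (A i)) ->
        P [set w | forall i, A i (row_tuple (Z w) i)] =
          (\prod_(i < n) P [set w | A i (row_tuple (Z w) i)])%E].

Definition coordinate p (j : 'I_p) (t : p.-tuple R) : R := tnth t j.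

Definition cov_mx p (mu : probability (p.-tuple R) R) : 'M[R]_p :=
  \matrix_(j, k) fine (covariance mu (coordinate j) (coordinate k)).

(* Joint fourth cumulant. The expectations are extended-real valued, and a sum
   is finite only if its terms are, so that finiteness of all fourth cumulants
   includes the integrability needed for them to be defined. *)
Definition cumulant4 d (T : measurableType d) (P : probability T R)
    (X1 X2 X3 X4 : T -> R) : \bar R :=
  let c (X : T -> R) := X \- cst (fine 'E_P[X]) in
  ('E_P[c X1 * c X2 * c X3 * c X4]
    - covariance P X1 X2 * covariance P X3 X4
    - covariance P X1 X3 * covariance P X2 X4
    - covariance P X1 X4 * covariance P X2 X3)%E.

Definition finite_fourth_cumulant p (mu : probability (p.-tuple R) R) : Prop :=
  forall j k l q : 'I_p,
    cumulant4 mu (coordinate j) (coordinate k) (coordinate l) (coordinate q) \is a fin_num.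

End Probability.

Section SketchingConditions.
Context {R : realType}.

(* For one realization of the data and dimension p + 1: [ell n] lists the
   singular values of X_n, and [frakP] is the condition on (U_n). *)
Definition conditionsC p (m : nat -> nat) (tau : nat -> R)
    (ell : nat -> 'rV[R]_p.+1) (U : forall n, 'M[R]_(n, p.+1))
    (frakP : (forall n, 'M[R]_(n, p.+1)) -> Prop) : Prop :=
  [/\ (limn_esup (fun n => (ell n 0 ord0 / ell n 0 ord_max)%:E) < +oo)%E,
      (1 < limn_einf (fun n => \big[mine/+oo]_(i < p)
         (ell n 0 (widen_ord (leqnSn p) i) / ell n 0 (lift ord0 i))%:E))%E,
      \forall n \near \oo, 0 < tau n,
      tau n / (m n)%:R @[n --> \oo] --> 0 &
      frakP U].

(* What the condition on (U_n) provides, for sketches S_n on (T, P). *)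
Definition sketch_clt d (T : measurableType d) (P : probability T R) p
    (m : nat -> nat) (S : forall n, T -> 'M[R]_(m n, n)) (tau : nat -> R)
    (U : forall n, 'M[R]_(n, p)) (G : nat -> 'M[R]_(p * p)) : Prop :=
  (exists c0 C0 : R, [/\ 0 < c0, c0 < C0 &
    \forall n \near \oo, [/\ absolutely_symmetric (G n),
      loewner_le (c0%:M) (compress (G n)) &
      loewner_le (compress (G n)) (C0%:M)]]) /\
  cvg_in_law P (std_normal (hdim p))
    (fun n w => Num.sqrt (m n)%:R *:
       (invsqrtmx (tau n *: compress (G n)) *m ((dup_mx p)^T *m
          vec ((U n)^T *m (S n w)^T *m S n w *m U n - 1%:M))))
    (@col_of_tuple R (hdim p)).

End SketchingConditions.

(* Main.v *)
Require Import Defs.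
From HB Require Import structures.
From mathcomp Require Import all_boot all_order all_algebra.
From mathcomp Require Import perm complex ring lra.
From mathcomp Require Import all_classical all_reals all_analysis measurable_realfun.

Set Implicit Arguments.
Unset Strict Implicit.
Unset Printing Implicit Defensive.

Import Order.TTheory GRing.Theory Num.Theory.
Import numFieldNormedType.Exports.

Local Open Scope classical_set_scope.
Local Open Scope ring_scope.

(** Fix the data. In the singular basis of [X_n] the sketched Gram matrix is
    [L (I + E) L] with [L = diag (l_1, ..., l_p)] and
    [E = U^T S^T S U - I]. The singular values stay comparable and separated, so
    the [i]-th eigenvector is the [i]-th coordinate vector up to [O(|E|)]; row
    [i] of the eigenvector equation then gives
    [Lhat_i / l_i^2 = 1 + E_ii + O(|E|^2)] ([perturbation]), where Weyl's
    inequality ([weyl]) says that the [i]-th eigenvalue is the one near [l_i^2].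

    The assumed limit theorem says that
    [W_n = sqrt m (tau D^T G D)^{-1/2} D^T vec E] is asymptotically standard
    normal. The leading term [sqrt (m / (tau G_ii)) E_ii] is [u_n . W_n] for a
    unit vector [u_n] ([invsqrt_standardize], [standardized_linform]), and the
    remainder is at most a constant times [sqrt (tau / m) |W_n|^2], hence small
    wherever [W_n] is bounded. The vectors [u_n] need not converge, but unit
    linear forms of a standard normal vector are all standard normal
    ([std_normal_linear]) and the sphere is compact, so [u_n . W_n] converges in
    law ([uniform_linform]) and, by tightness, so does anything that is close to
    it on bounded sets of [W_n] ([slutsky_linform]).

    Replacing [l_i^2 = lambda_i (X_n^T X_n)] by the population eigenvalue costs
    [O(n^{-1/2})], by Weyl's inequality again and because the sample covariance
    has variance [O(1/n)] under fourth moments ([sample_covariance_rate]);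
    multiplied by [sqrt (m / (tau G_ii))] this vanishes by the sample size
    condition ([conditional_limit]).

    That cost is controlled in probability only, whereas the limit given the data
    holds almost surely. No subsequence is extracted: on the event that the
    covariance error is at most [K / sqrt n] the conditional expectations of a
    bounded continuous test function converge almost surely, the complement has
    probability [O(1/K^2)] uniformly in [n], and dominated convergence followed
    by Fubini's theorem concludes ([cvg_mix]). *)

(** * Spectral theory of real symmetric matrices *)

Section Spectral.
Context {R : realType}.

Lemma dot_ge0 n (x : 'rV[R]_n) : 0 <= (x *m x^T) 0 0.
Proof. by rewrite mxE sumr_ge0 // => j _; rewrite mxE -expr2 sqr_ge0. Qed.

Lemma dot_eq0 n (x : 'rV[R]_n) : (x *m x^T) 0 0 = 0 -> x = 0.
Proof.
rewrite mxE => /eqP; rewrite psumr_eq0 => [/allP x0|j _].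
  apply/rowP => j; have := x0 j (mem_index_enum j).
  by rewrite /= !mxE -expr2 sqrf_eq0 => /eqP.
by rewrite mxE -expr2 sqr_ge0.
Qed.

(** The characteristic polynomial has a complex root, and symmetry makes it real. *)
Lemma real_eigenvector n (A : 'M[R]_n.+1) : A^T = A ->
  exists (a : R) (v : 'rV[R]_n.+1), v *m A = a *: v /\ v *m v^T = 1%:M.
Proof.
move=> symA.
suff [a [v [vA v0]]] : exists (a : R) (v : 'rV[R]_n.+1), v *m A = a *: v /\ v != 0.
  pose c := (v *m v^T) 0 0.
  have c_gt0 : 0 < c.
    by rewrite lt_def dot_ge0 andbT; apply: contra v0 => /eqP/dot_eq0 ->.
  exists a, ((Num.sqrt c)^-1 *: v); rewrite -scalemxAl vA scalerA mulrC -scalerA.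
  split=> //; rewrite linearZ /= -scalemxAl -scalemxAr scalerA.
  rewrite [v *m v^T]mx11_scalar -/c -scalemx1 scalerA -invfM -expr2.
  by rewrite sqr_sqrtr ?ltW // mulVf ?gt_eqF // scale1r.
pose toC := @real_complex R.
(* the real and imaginary parts of a complex eigenvector for [al + i be] are
   rotated into each other by [A]; symmetry of [A] forces [be = 0] *)
have [a ra] : exists a : R[i], root (char_poly (map_mx toC A)) a.
  by apply/closed_rootP; rewrite size_char_poly.
move: ra; rewrite -eigenvalue_root_char => /eigenvalueP[v vA v0].
pose x : 'rV[R]_n.+1 := map_mx (@complex.Re R) v.
pose y : 'rV[R]_n.+1 := map_mx (@complex.Im R) v.
pose al := complex.Re a; pose be := complex.Im a.
have xA : x *m A = al *: x - be *: y.
  apply/rowP => j; have := congr1 (fun z : 'rV[R[i]]_n.+1 => complex.Re (z 0 j)) vA.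
  rewrite /= !mxE raddf_sum /= /al /be.
  move: (v 0 j) => [vr vi]; case: (a) => [ar ai] /= => <-.
  by apply: eq_bigr => k _; rewrite !mxE; case: (v 0 k) => [? ?] /=; rewrite mulr0 subr0.
have yA : y *m A = al *: y + be *: x.
  apply/rowP => j; have := congr1 (fun z : 'rV[R[i]]_n.+1 => complex.Im (z 0 j)) vA.
  rewrite /= !mxE raddf_sum /= /al /be.
  move: (v 0 j) => [vr vi]; case: (a) => [ar ai] /= => <-.
  by apply: eq_bigr => k _; rewrite !mxE; case: (v 0 k) => [? ?] /=; rewrite mulr0 add0r.
have xy_neq0 : x = 0 -> y = 0 -> False.
  move=> x0 y0; move/eqP: v0; apply; apply/rowP => j.
  move/rowP/(_ j): x0; move/rowP/(_ j): y0; rewrite !mxE.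
  by case: (v 0 j) => ? ? /= -> ->.
have be0 : be = 0.
  have sq_gt0 : 0 < (x *m x^T) 0 0 + (y *m y^T) 0 0.
    rewrite lt_def addr_ge0 ?dot_ge0 // andbT.
    rewrite paddr_eq0 ?dot_ge0 //; apply/negP => /andP[/eqP/dot_eq0 x0 /eqP/dot_eq0 y0].
    exact: xy_neq0 x0 y0.
  have : (x *m A *m y^T) 0 0 = (y *m A *m x^T) 0 0.
    have -> : y *m A *m x^T = (x *m A *m y^T)^T by rewrite !trmx_mul trmxK symA mulmxA.
    by rewrite [RHS]mxE.
  have tr_yx : (y *m x^T) 0 0 = (x *m y^T) 0 0.
    by rewrite -[y *m _]trmxK trmx_mul trmxK [LHS]mxE.
  rewrite xA yA mulmxBl mulmxDl -!scalemxAl.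
  have BE (M N : 'M[R]_1) : (M - N) 0 0 = M 0 0 - N 0 0 by rewrite !mxE.
  have DE (M N : 'M[R]_1) : (M + N) 0 0 = M 0 0 + N 0 0 by rewrite mxE.
  have ZE k (M : 'M[R]_1) : (k *: M) 0 0 = k * M 0 0 by rewrite mxE.
  rewrite BE DE !ZE tr_yx.
  move: sq_gt0; set X := (x *m x^T) 0 0; set Y := (y *m y^T) 0 0; move=> XY.
  move/addrI => E; have : be * (X + Y) = 0 by rewrite mulrDr -E addNr.
  by move=> /eqP; rewrite mulf_eq0 (gt_eqF XY) orbF => /eqP.
have [x0|x_neq0] := eqVneq x 0.
  exists al, y; split; first by rewrite yA be0 scale0r addr0.
  by apply/eqP => y0; exact: xy_neq0 x0 y0.
by exists al, x; rewrite xA be0 scale0r subr0.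
Qed.

(** A Householder reflection exchanges the first basis vector and [v], so its first
    row is [v]. *)
Lemma orthonormal_completion n (v : 'rV[R]_n.+1) : v *m v^T = 1%:M ->
  exists Q : 'M[R]_n.+1, [/\ Q^T = Q, Q *m Q^T = 1%:M & row 0 Q = v].
Proof.
move=> v1.
pose e : 'rV[R]_n.+1 := delta_mx 0 0; pose w := v - e.
(* [w . w = 2 c] and [e . w = - c], so the reflection along [w] swaps [e] and [v] *)
have eT (x : 'rV[R]_n.+1) : (x *m e^T) = (x 0 0)%:M.
  apply/rowP => j; rewrite ord1 trmx_delta -colE !mxE eqxx mulr1n //.
have Te (x : 'rV[R]_n.+1) : (e *m x^T) = (x 0 0)%:M.
  by rewrite -[e *m _]trmxK trmx_mul trmxK eT tr_scalar_mx.
pose c : R := 1 - v 0 0.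
have ww : w *m w^T = (2 * c)%:M.
  rewrite /w linearB /= mulmxBl !mulmxBr v1 eT Te eT -!raddfB /= /c mxE !eqxx /=.
  by congr _%:M; ring.
have ew : e *m w^T = (- c)%:M.
  by rewrite /w linearB /= mulmxBr Te eT -raddfB /= mxE !eqxx /= /c; congr _%:M; ring.
have [c0|c_neq0] := eqVneq c 0.
  have w0 : w = 0 by apply: dot_eq0; rewrite ww c0 mulr0 mxE mul0rn.
  exists 1%:M; split; rewrite ?trmx1 ?mulmx1 //.
  have -> : v = e by apply/eqP; rewrite -subr_eq0 -/w w0.
  by rewrite rowE mulmx1.
have vE : v = e + w by rewrite addrC subrK.
clearbody w c.
have symQ : (1%:M - c^-1 *: (w^T *m w))^T = 1%:M - c^-1 *: (w^T *m w).
  by rewrite linearB /= trmx1 linearZ /= trmx_mul trmxK.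
exists (1%:M - c^-1 *: (w^T *m w)); split => //.
  have PP : (w^T *m w) *m (w^T *m w) = (2 * c) *: (w^T *m w).
    by rewrite mulmxA -[w^T *m w *m w^T]mulmxA ww mul_mx_scalar -scalemxAl.
  rewrite symQ; move: PP; set P := w^T *m w => PP.
  rewrite mulmxBl mul1mx mulmxBr mulmx1 -scalemxAl -scalemxAr PP !scalerA.
  have -> : c^-1 / c * (2 * c) = c^-1 + c^-1 by field.
  by rewrite scalerDl opprB addrK subrK.
rewrite rowE mulmxBr mulmx1 -scalemxAr mulmxA ew mul_scalar_mx scalerA.
by rewrite mulrN mulVf // scaleN1r opprK vE.
Qed.

End Spectral.

Section Eigvals.
Context {R : realType}.

(** Deflation: in an orthonormal basis that starts with a unit eigenvector, a
    symmetric matrix is block diagonal. *)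
Lemma spectral n (A : 'M[R]_n) : A^T = A ->
  exists (Q : 'M[R]_n) (s : 'rV[R]_n), Q *m Q^T = 1%:M /\ Q *m A *m Q^T = diag_mx s.
Proof.
elim: n A => [|n IHn] A symA.
  by exists 1%:M, 0; split; apply/matrixP => -[].
have [a [v [vA v1]]] := real_eigenvector symA.
have [P [symP PPT rowP]] := orthonormal_completion v1.
have [B defB] : exists B : 'M[R]_(1 + n), B = P *m A *m P^T by exists (P *m A *m P^T).
have symB : B^T = B by rewrite defB !trmx_mul trmxK symA mulmxA.
have B0 j : B 0 j = (j == 0)%:R * a.
  have -> : B 0 j = (row 0 B) 0 j by rewrite [RHS]mxE.
  rewrite defB !row_mul rowP vA -scalemxAl -rowP -row_mul PPT.
  by rewrite !mxE mulrC eq_sym.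
have BE : B = block_mx a%:M 0 0 (drsubmx B).
  rewrite -[LHS]submxK; congr block_mx.
  - apply/matrixP => i j; rewrite !ord1 !mxE.
    have -> : lshift n (0 : 'I_1) = 0 by apply: val_inj.
    by rewrite B0 eqxx mul1r mulr1n.
  - apply/matrixP => i j; rewrite !ord1 !mxE.
    have -> : lshift n (0 : 'I_1) = 0 by apply: val_inj.
    by rewrite B0 mul0r.
  - apply/matrixP => i j; rewrite !ord1 -symB !mxE.
    have -> : lshift n (0 : 'I_1) = 0 by apply: val_inj.
    by rewrite B0 mul0r.
have [Q [s [QQT QBQ]]] : exists (Q : 'M[R]_n) (s : 'rV[R]_n),
    Q *m Q^T = 1%:M /\ Q *m drsubmx B *m Q^T = diag_mx s.
  by apply: IHn; rewrite trmx_drsub symB.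
pose K : 'M[R]_(1 + n) := block_mx 1%:M 0 0 Q.
have KK : K *m K^T = 1%:M.
  rewrite /K tr_block_mx mulmx_block !trmx0 trmx1.
  by rewrite !mulmx0 !mul0mx !mulmx1 !addr0 !add0r QQT -scalar_mx_block.
have KBK : K *m B *m K^T = diag_mx (row_mx a%:M s).
  rewrite BE /K tr_block_mx mulmx_block !mul1mx !mul0mx !mulmx0 !addr0 !add0r.
  rewrite mulmx_block !trmx0 trmx1 !mulmx0 !mul0mx !mulmx1 !addr0 !add0r QBQ.
  rewrite diag_mx_row; congr block_mx.
  by apply/matrixP => i j; rewrite !ord1 !mxE eqxx !mulr1n.
exists (K *m P : 'M[R]_n.+1), (row_mx a%:M s); split.
  by rewrite trmx_mul mulmxA -[K *m P *m P^T]mulmxA PPT mulmx1 KK.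
by rewrite -KBK defB trmx_mul !mulmxA.
Qed.

(** Unique factorization; together with sorting, this is what makes [eigvals] well
    defined. *)
Lemma prod_XsubC_perm_eq (s t : seq R) :
  \prod_(x <- s) ('X - x%:P) = \prod_(x <- t) ('X - x%:P) -> perm_eq s t.
Proof.
elim: s t => [|x s IHs] t.
  move/(congr1 (fun q : {poly R} => size q)); rewrite !size_prod_XsubC => -[].
  by case: t.
move=> E; have xt : x \in t by rewrite -root_prod_XsubC -E root_prod_XsubC mem_head.
rewrite (permPr (perm_to_rem xt)) perm_cons; apply: IHs.
move: E; rewrite (perm_big _ (perm_to_rem xt)) !big_cons => /mulfI; apply.
by rewrite polyXsubC_eq0.
Qed.

Lemma eigvals_unique n (A : 'M[R]_n) (s : n.-tuple R) :
  sorted >=%R s -> char_poly A = \prod_(x <- s) ('X - x%:P) -> eigvals A = s.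
Proof.
move=> ss sA; rewrite /eigvals; apply: xget_unique => // t [st tA].
apply: val_inj; apply: (sorted_eq ge_trans ge_anti) => //.
by apply: prod_XsubC_perm_eq; rewrite -tA.
Qed.

Lemma char_poly_conj n (Q A : 'M[R]_n) : Q *m Q^T = 1%:M ->
  char_poly (Q *m A *m Q^T) = char_poly A.
Proof.
move=> QQ; rewrite /char_poly /char_poly_mx.
have E : map_mx (@polyC R) Q *m map_mx (@polyC R) Q^T = 1%:M.
  by rewrite -map_mxM QQ map_mx1.
have -> : 'X%:M - map_mx (@polyC R) (Q *m A *m Q^T) =
    map_mx (@polyC R) Q *m ('X%:M - map_mx (@polyC R) A) *m map_mx (@polyC R) Q^T.
  rewrite mulmxBr mulmxBl -!map_mxM; congr (_ - _).
  by rewrite mul_mx_scalar -scalemxAl E scalemx1.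
by rewrite !det_mulmx mulrAC -det_mulmx E det1 mul1r.
Qed.

Lemma lambda_conj n (Q A : 'M[R]_n) : Q *m Q^T = 1%:M ->
  lambda (Q *m A *m Q^T) = lambda A.
Proof. by move=> QQ; rewrite /lambda /eigvals char_poly_conj. Qed.

Lemma char_poly_diag n (s : 'rV[R]_n) :
  char_poly (diag_mx s) = \prod_i ('X - (s 0 i)%:P).
Proof.
rewrite char_poly_trig; last exact/diag_mx_is_trig.
by apply: eq_bigr => i _; rewrite mxE eqxx mulr1n.
Qed.

Lemma lambda_diag n (s : 'rV[R]_n) :
  (forall i j : 'I_n, (i <= j)%N -> s 0 j <= s 0 i) ->
  forall i, lambda (diag_mx s) i = s 0 i.
Proof.
move=> s_noninc i; rewrite /lambda.
rewrite (@eigvals_unique _ _ [tuple s 0 i | i < n]) ?tnth_mktuple //.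
  case: n s s_noninc i => [s _ []//|n] s s_noninc _.
  apply/(sortedP 0) => k; rewrite size_tuple => kn.
  have -> : nth 0 [tuple s 0 i | i < n.+1] k = s 0 (Ordinal (ltnW kn)).
    by rewrite -[k in LHS]/(val (Ordinal (ltnW kn))) -tnth_nth tnth_mktuple.
  have -> : nth 0 [tuple s 0 i | i < n.+1] k.+1 = s 0 (Ordinal kn).
    by rewrite -[k.+1 in LHS]/(val (Ordinal kn)) -tnth_nth tnth_mktuple.
  by apply: s_noninc => /=.
by rewrite char_poly_diag big_tuple; apply: eq_bigr => k _; rewrite tnth_mktuple.
Qed.

Lemma spectral_lambda n (A : 'M[R]_n) : A^T = A ->
  exists Q : 'M[R]_n, [/\ Q *m Q^T = 1%:M,
    Q *m A *m Q^T = diag_mx (\row_i lambda A i) &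
    forall i j : 'I_n, (i <= j)%N -> lambda A j <= lambda A i].
Proof.
move=> symA; have [P [s [PP PAP]]] := spectral symA.
pose s0 := [tuple s 0 i | i < n].
have /tuple_permP[sg sgE] : perm_eq (sort >=%R s0) s0 by rewrite perm_sort.
pose t := \row_i s 0 (sg i).
pose Q := row_perm sg P.
have conjQ M : Q *m M *m Q^T = \matrix_(i, j) (P *m M *m P^T) (sg i) (sg j).
  apply/matrixP => i j; rewrite !mxE; apply: eq_bigr => k _; rewrite !mxE.
  by congr (_ * _); apply: eq_bigr => l _; rewrite mxE.
have QQ : Q *m Q^T = 1%:M.
  have := conjQ 1%:M; rewrite !mulmx1 PP => ->; apply/matrixP => i j; rewrite !mxE.
  by rewrite (inj_eq perm_inj).
have QAQ : Q *m A *m Q^T = diag_mx t.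
  rewrite conjQ PAP; apply/matrixP => i j; rewrite !mxE (inj_eq perm_inj).
  by have [->|] := eqVneq i j.
have t_noninc (i j : 'I_n) : (i <= j)%N -> t 0 j <= t 0 i.
  move=> ij; have := sort_sorted (@ge_total _ R) s0.
  have tE (k : 'I_n) : t 0 k = nth 0 (sort >=%R s0) k.
    by rewrite sgE -tnth_nth !tnth_mktuple mxE.
  rewrite !tE => /(sorted_leq_nth ge_trans (@lexx _ R)); apply => //.
    by rewrite inE size_sort size_tuple.
  by rewrite inE size_sort size_tuple.
have lamE i : lambda A i = t 0 i.
  by rewrite -(lambda_conj A QQ) QAQ lambda_diag.
exists Q; split => // [|i j ij]; last by rewrite !lamE t_noninc.
by rewrite QAQ; congr diag_mx; apply/rowP => i; rewrite [RHS]mxE lamE.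
Qed.

End Eigvals.

Section Weyl.
Context {R : realType}.

Lemma quad_diag n (s y : 'rV[R]_n) :
  (y *m diag_mx s *m y^T) 0 0 = \sum_k s 0 k * y 0 k ^+ 2.
Proof.
rewrite mul_mx_diag mxE; apply: eq_bigr => k _; rewrite !mxE.
by rewrite mulrAC -expr2 mulrC.
Qed.

Lemma quad_conj n (Q A D : 'M[R]_n) (x : 'rV[R]_n) : Q *m Q^T = 1%:M ->
  Q *m A *m Q^T = D -> x *m A *m x^T = (x *m Q^T) *m D *m (x *m Q^T)^T.
Proof.
move=> QQ <-; have QtQ := mulmx1C QQ.
rewrite trmx_mul trmxK !mulmxA -[x *m Q^T *m Q]mulmxA QtQ mulmx1.
by rewrite -[_ *m Q^T *m Q]mulmxA QtQ mulmx1.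
Qed.

(** The Courant-Fischer dimension count: the span of the first [i + 1] eigenvectors
    of [A] meets the span of the eigenvectors of [B] of index at least [i], and on
    a common vector the two quadratic forms compare the eigenvalues. *)
Lemma weyl_le n (A B : 'M[R]_n) (e : R) : A^T = A -> B^T = B ->
  (forall x : 'rV[R]_n,
     (x *m A *m x^T) 0 0 <= (x *m B *m x^T) 0 0 + e * (x *m x^T) 0 0) ->
  forall i, lambda A i <= lambda B i + e.
Proof.
move=> symA symB AB i.
have [P [PP PAP Anoninc]] := spectral_lambda symA.
have [Q [QQ QBQ Bnoninc]] := spectral_lambda symB.
pose C := P *m Q^T.
(* [y N = 0] says that [y] is supported on the first [i + 1] coordinates and that
   [y C] vanishes on the first [i] *)
pose N : 'M[R]_n := \matrix_(k, l)
  if (l < i)%N then C k l else if (i < l)%N then (k == l)%:R else 0.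
(* column [i] of [N] vanishes, hence so does [y N] for some nonzero [y] *)
have /eqP/det0P[y y0 yN] : \det N = 0.
  apply/eqP; rewrite -det_tr; apply/det0P; exists (delta_mx 0 i).
    by apply/eqP => /rowP/(_ i)/eqP; rewrite !mxE !eqxx oner_eq0.
  by apply/rowP => l; rewrite -rowE !mxE ltnn.
have y_gt (l : 'I_n) : (i < l)%N -> y 0 l = 0.
  move=> il; have /rowP/(_ l) := yN; rewrite !mxE (bigD1 l) //= big1 => [|k kl].
    by rewrite !mxE ltnNge (ltnW il) /= il eqxx mulr1 addr0.
  by rewrite !mxE ltnNge (ltnW il) /= il (negbTE kl) mulr0.
have z_lt (l : 'I_n) : (l < i)%N -> (y *m C) 0 l = 0.
  move=> li; have /rowP/(_ l) := yN; rewrite mxE [RHS]mxE => <-; rewrite mxE.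
  by apply: eq_bigr => k _; rewrite [N k l]mxE li.
have [x defx] : exists x, x = y *m P by eexists.
have xP : x *m P^T = y by rewrite defx -mulmxA PP mulmx1.
have xQ : x *m Q^T = y *m C by rewrite defx /C mulmxA.
have xx_y : x *m x^T = y *m y^T.
  by rewrite {2}defx trmx_mul mulmxA xP.
have xx_z : x *m x^T = (x *m Q^T) *m (x *m Q^T)^T.
  by rewrite trmx_mul trmxK mulmxA -[x *m Q^T *m Q]mulmxA (mulmx1C QQ) mulmx1.
have dotE (t : 'rV[R]_n) : (t *m t^T) 0 0 = \sum_k t 0 k ^+ 2.
  by rewrite mxE; apply: eq_bigr => k _; rewrite mxE -expr2.
have y_gt0 : 0 < (x *m x^T) 0 0.
  by rewrite xx_y lt_def dot_ge0 andbT; apply: contra y0 => /eqP/dot_eq0 ->.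
have lbA : lambda A i * (x *m x^T) 0 0 <= (x *m A *m x^T) 0 0.
  rewrite xx_y dotE (quad_conj x PP PAP) xP quad_diag mulr_sumr.
  apply: ler_sum => k _; rewrite mxE; have [ki|ik] := leqP k i.
    by rewrite ler_wpM2r ?sqr_ge0 // Anoninc.
  by rewrite y_gt // expr0n !mulr0.
have ubB : (x *m B *m x^T) 0 0 <= lambda B i * (x *m x^T) 0 0.
  rewrite xx_z dotE (quad_conj x QQ QBQ) xQ quad_diag mulr_sumr.
  apply: ler_sum => k _; rewrite [in leLHS]mxE; have [ki|ik] := leqP i k.
    by rewrite ler_wpM2r ?sqr_ge0 // Bnoninc.
  by rewrite z_lt // expr0n !mulr0.
rewrite -(ler_pM2r y_gt0) mulrDl (le_trans lbA) // (le_trans (AB x)) //.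
by rewrite lerD2r.
Qed.

(** The factor [n] comes from [2 |x_j x_k| <= x_j^2 + x_k^2]; a crude bound is enough
    because the dimension is fixed. *)
Lemma quad_le n (M : 'M[R]_n) (e : R) (x : 'rV[R]_n) :
  (forall j k, `|M j k| <= e) -> (x *m M *m x^T) 0 0 <= n%:R * e * (x *m x^T) 0 0.
Proof.
move=> Me; have -> : (x *m M *m x^T) 0 0 = \sum_k \sum_j x 0 j * M j k * x 0 k.
  rewrite mxE; apply: eq_bigr => k _; rewrite !mxE big_distrl /=.
  by apply: eq_bigr => j _.
have -> : n%:R * e * (x *m x^T) 0 0 =
    \sum_(k < n) \sum_(j < n) (e * x 0 j ^+ 2 / 2 + e * x 0 k ^+ 2 / 2).
  under [RHS]eq_bigr do rewrite big_split /= sumr_const card_ord.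
  rewrite big_split /= sumr_const card_ord sumrMnl -mulrnDl -big_split /=.
  under [in RHS]eq_bigr do rewrite -splitr.
  rewrite -mulrA mulr_natl mxE mulr_sumr; congr (_ *+ _).
  by apply: eq_bigr => j _; rewrite mxE expr2.
apply: ler_sum => k _; apply: ler_sum => j _.
have /ler_normlP[M1 M2] := Me j k.
have := sqr_ge0 (x 0 j - x 0 k); have := sqr_ge0 (x 0 j + x 0 k).
move: (M j k) M1 M2 (x 0 j) (x 0 k) => q q1 q2 a b p1 p2.
have e0 : 0 <= e - q by lra.
have e1 : 0 <= e + q by lra.
have := mulr_ge0 e0 p1; have := mulr_ge0 e1 p2; lra.
Qed.

(** Stated with entries rather than the operator norm, since all the errors that
    occur later are controlled entrywise. *)
Lemma weyl n (A B : 'M[R]_n) (e : R) : A^T = A -> B^T = B ->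
  (forall j k, `|A j k - B j k| <= e) ->
  forall i, `|lambda A i - lambda B i| <= n%:R * e.
Proof.
move=> symA symB ABe i; rewrite ler_distl; apply/andP; split.
  rewrite lerBlDr; apply: weyl_le => // x; rewrite -lerBlDl.
  have <- : (x *m (B - A) *m x^T) 0 0 = (x *m B *m x^T) 0 0 - (x *m A *m x^T) 0 0.
    by rewrite mulmxBr mulmxBl !mxE.
  by apply: quad_le => j k; rewrite !mxE distrC.
apply: weyl_le => // x; rewrite -lerBlDl.
have <- : (x *m (A - B) *m x^T) 0 0 = (x *m A *m x^T) 0 0 - (x *m B *m x^T) 0 0.
  by rewrite mulmxBr mulmxBl !mxE.
by apply: quad_le => j k; rewrite !mxE.
Qed.

Lemma lambda_eigenvector n (A : 'M[R]_n) i : A^T = A ->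
  exists2 x : 'rV[R]_n, x *m A = lambda A i *: x & x != 0.
Proof.
move=> symA; have [Q [QQ QAQ _]] := spectral_lambda symA.
exists (row i Q).
  have : Q *m A = diag_mx (\row_i lambda A i) *m Q.
    by rewrite -QAQ -mulmxA (mulmx1C QQ) mulmx1.
  move/(congr1 (row i)); rewrite !row_mul => ->.
  by rewrite row_diag_mx mxE -scalemxAl -rowE.
apply/eqP => Qi0; have := congr1 (row i) QQ.
rewrite row_mul Qi0 mul0mx => /rowP/(_ i)/eqP.
by rewrite !mxE eqxx eq_sym oner_eq0.
Qed.

Lemma lambda_gt0 n (A : 'M[R]_n) i : posdefmx A -> 0 < lambda A i.
Proof.
move=> [symA posA]; have [x xA x0] := lambda_eigenvector i symA.
have /posA : x^T != 0 by apply: contra x0 => /eqP x0; rewrite -[x]trmxK x0 trmx0.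
rewrite trmxK xA -scalemxAl mxE; apply: contraTT; rewrite -!leNgt => l0.
by rewrite mulr_le0_ge0 // dot_ge0.
Qed.

End Weyl.

(** * Second-order perturbation of separated singular values *)

Section Perturbation.
Context {R : realType}.

(** Weyl's inequality puts the eigenvalue within [O(e)] of [l_i^2], away from the
    other [l_j^2]. The rows [j != i] of the eigenvector equation then bound the
    off-diagonal coordinates of the eigenvector by [O(e)], and in row [i] they are
    multiplied once more by entries of [E]. *)
Lemma perturbation n (l : 'rV[R]_n) (E : 'M[R]_n) (i : 'I_n) (kappa g e : R) :
  E^T = E -> (forall j, 0 < l 0 j) ->
  (forall j k : 'I_n, (j <= k)%N -> l 0 k <= l 0 j) ->
  (forall j, l 0 j <= kappa * l 0 i) ->
  (forall j, j != i -> g * l 0 i ^+ 2 <= `|l 0 i ^+ 2 - l 0 j ^+ 2|) ->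
  (forall j k, `|E j k| <= e) -> 0 < g -> 4 * (n%:R * kappa ^+ 2 * e) <= g ->
  `|lambda (diag_mx l *m (1%:M + E) *m diag_mx l) i / l 0 i ^+ 2 - 1 - E i i|
    <= 2 * n%:R ^+ 2 * kappa ^+ 3 / g * e ^+ 2.
Proof.
move=> symE l_gt0 l_noninc l_kappa l_gap Ee g_gt0 e_small.
set M := _ *m _ *m _; set lam := lambda M i; set L := l 0 i ^+ 2.
have L_gt0 : 0 < L by rewrite exprn_gt0.
have e_ge0 : 0 <= e by rewrite (le_trans _ (Ee i i)).
have k_ge0 : 0 <= kappa.
  by rewrite -(ler_pM2r (l_gt0 i)) mul0r (le_trans _ (l_kappa i)) // ltW.
have symM : M^T = M.
  by rewrite /M !trmx_mul linearD /= trmx1 symE !tr_diag_mx mulmxA.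
have ME j k : M j k = l 0 j * ((j == k)%:R + E j k) * l 0 k.
  by rewrite /M mul_mx_diag mxE mul_diag_mx !mxE.
have lEl j k : `|l 0 j * E j k * l 0 k| <= kappa ^+ 2 * e * L.
  have -> : kappa ^+ 2 * e * L = (kappa * l 0 i) * e * (kappa * l 0 i) by rewrite /L; ring.
  rewrite !normrM !(gtr0_norm (l_gt0 _)); apply: ler_pM; rewrite ?mulr_ge0 ?(ltW (l_gt0 _)) //.
  by apply: ler_pM; rewrite ?(ltW (l_gt0 _)).
have lamL : `|lam - L| <= n%:R * (kappa ^+ 2 * e * L).
  have diagE : lambda (diag_mx (\row_j l 0 j ^+ 2)) i = L.
    rewrite lambda_diag ?mxE // => j k jk; rewrite !mxE.
    by rewrite lerXn2r ?nnegrE ?(ltW (l_gt0 _)) ?l_noninc.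
  rewrite -{1}diagE; apply: weyl => // [|j k]; first by rewrite tr_diag_mx.
  suff -> : M j k - diag_mx (\row_j l 0 j ^+ 2) j k = l 0 j * E j k * l 0 k by exact: lEl.
  by rewrite ME !mxE; have [<-|jk] := eqVneq j k; rewrite ?mulr1n ?mulr0n /=; ring.
have small : n%:R * (kappa ^+ 2 * e * L) <= g / 4 * L.
  by have := ler_wpM2r (ltW L_gt0) e_small; lra.
have lamL' : `|lam - L| <= g / 4 * L by exact: le_trans lamL small.
have [x xM x0] := lambda_eigenvector i symM.
have rowE j : (lam - l 0 j ^+ 2) * x 0 j = \sum_k x 0 k * (l 0 k * E k j * l 0 j).
  have /rowP/(_ j) := xM; rewrite !mxE mulrBl => <-.
  have -> : l 0 j ^+ 2 * x 0 j = \sum_k x 0 k * (l 0 k * (k == j)%:R * l 0 j).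
    rewrite (bigD1 j) //= big1 ?addr0 ?eqxx => [|k /negbTE ->]; last by rewrite mulr0 mul0r mulr0.
    by rewrite mulr1; ring.
  by rewrite -sumrB; apply: eq_bigr => k _; rewrite ME; ring.
have sum_le (j : 'I_n) (c : R) : (forall k, `|x 0 k| <= c) ->
    `|(lam - l 0 j ^+ 2) * x 0 j| <= n%:R * (kappa ^+ 2 * e * L) * c.
  move=> xc; rewrite rowE; apply: le_trans (ler_norm_sum _ _ _) _.
  rewrite -mulrA mulr_natl -[X in _ *+ X](card_ord n) -sumr_const.
  apply: ler_sum => k _; rewrite normrM mulrC.
  by apply: ler_pM.
have gap j : j != i -> 3 / 4 * g * L <= `|lam - l 0 j ^+ 2|.
  move=> ji; have := l_gap j ji; rewrite -/L => gapj.
  have := ler_normD (lam - l 0 j ^+ 2) (L - lam).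
  have -> : lam - l 0 j ^+ 2 + (L - lam) = L - l 0 j ^+ 2 by ring.
  rewrite [`|L - lam|]distrC; move: lamL' gapj; set a := `|_|; set b := `|_|; set c := `|_|.
  by move=> *; lra.
(* the largest coordinate of the eigenvector is the [i]-th, since the other rows
   of the eigenvector equation have a factor bounded away from 0 on the left *)
have [a _ xa] : exists2 a, true & forall k, `|x 0 k| <= `|x 0 a|.
  exists [arg max_(a > i) `|x 0 a|]%O => //.
  by case: Order.TotalTheory.arg_maxP => //= a _ ha k; apply: ha.
have xa_gt0 : 0 < `|x 0 a|.
  rewrite normr_gt0; apply: contra x0 => /eqP xa0; apply/eqP/rowP => k; rewrite mxE.
  by apply/eqP; rewrite -normr_le0 (le_trans (xa k)) // xa0 normr0.
have gL_gt0 : 0 < g * L by rewrite mulr_gt0.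
have ai : a = i.
  apply/eqP; apply: contraT => ai.
  have := sum_le a _ xa; rewrite normrM ler_pM2r // => h.
  have : (0 : R) < 0 by have := gap a ai; move: h small gL_gt0 => h1 h2 h3 h4; lra.
  by rewrite ltxx.
subst a.
have xj_le j : j != i -> `|x 0 j| <= 2 * n%:R * kappa ^+ 2 / g * e * `|x 0 i|.
  move=> ji; have := sum_le j _ xa; rewrite normrM => h.
  have h2 : 3 / 4 * g * L * `|x 0 j| <= n%:R * (kappa ^+ 2 * e * L) * `|x 0 i|.
    by apply: le_trans h; rewrite ler_wpM2r // gap.
  rewrite -(ler_pM2l gL_gt0).
  have -> : g * L * (2 * n%:R * kappa ^+ 2 / g * e * `|x 0 i|) =
     2 * (n%:R * (kappa ^+ 2 * e * L) * `|x 0 i|) by field; rewrite gt_eqF.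
  have : 0 <= g * L * `|x 0 j| by rewrite mulr_ge0 // ltW.
  by move: h2; move=> *; lra.
have fin : `|(lam - L - L * E i i) * x 0 i| <=
    n%:R * (kappa * L * e * (2 * n%:R * kappa ^+ 2 / g * e * `|x 0 i|)).
  have -> : (lam - L - L * E i i) * x 0 i = \sum_(k | k != i) x 0 k * (l 0 k * E k i * l 0 i).
    rewrite mulrBl rowE (bigD1 i) //= /L.
    by move: (\sum_(k | k != i) _) => rest; ring.
  apply: le_trans (ler_norm_sum _ _ _) _.
  rewrite mulr_natl -[X in _ *+ X](card_ord n) -sumr_const.
  rewrite [leLHS]big_mkcond; apply: ler_sum => k _; case: ifPn => ki; last first.
    by do ?apply: mulr_ge0; rewrite ?invr_ge0 ?exprn_ge0 ?(ltW g_gt0) ?(ltW (l_gt0 _)).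
  rewrite normrM mulrC; apply: ler_pM => //; last exact: xj_le.
  rewrite !normrM !(gtr0_norm (l_gt0 _)).
  have -> : kappa * L * e = kappa * l 0 i * e * l 0 i by rewrite /L; ring.
  rewrite ler_wpM2r ?(ltW (l_gt0 _)) //; apply: ler_pM => //; exact: ltW (l_gt0 _).
rewrite -(ler_pM2r xa_gt0) -(ler_pM2l L_gt0).
have -> : lam / L - 1 - E i i = (lam - L - L * E i i) / L by field; rewrite gt_eqF.
rewrite normrM normfV (gtr0_norm L_gt0) mulrA mulrCA mulfV ?gt_eqF // mulr1 -normrM.
apply: (le_trans fin); rewrite le_eqVlt; apply/orP; left; apply/eqP.
by field; rewrite gt_eqF.
Qed.

End Perturbation.

(** * Inverse square roots of positive definite matrices *)

Section InvSqrt.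
Context {R : realType}.

Lemma posdef_unit n (A : 'M[R]_n) : posdefmx A -> A \in unitmx.
Proof.
move=> [symA posA]; rewrite unitmxE unitfE; apply/negP => /det0P[v v0 vA].
have /posA : v^T != 0 by apply: contra v0 => /eqP v0; rewrite -[v]trmxK v0 trmx0.
by rewrite trmxK vA mul0mx mxE ltxx.
Qed.

Lemma posdef_diag_gt0 n (A : 'M[R]_n) b : posdefmx A -> 0 < A b b.
Proof.
move=> [symA posA]; have /posA : delta_mx b 0 != 0 :> 'cV[R]_n.
  by apply/eqP => /colP/(_ b)/eqP; rewrite !mxE !eqxx oner_eq0.
by rewrite trmx_delta -rowE -colE !mxE.
Qed.

(** Existence is read off a spectral decomposition; the two properties are all that
    is known of the value picked by [invsqrtmx]. *)
Lemma invsqrtmxP n (A : 'M[R]_n) : posdefmx A ->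
  posdefmx (invsqrtmx A) /\ invsqrtmx A *m invsqrtmx A = invmx A.
Proof.
move=> posA; have [symA _] := posA.
have [Q [QQ QAQ _]] := spectral_lambda symA.
pose s : 'rV[R]_n := \row_i (Num.sqrt (lambda A i))^-1.
have s_gt0 i : 0 < s 0 i by rewrite mxE invr_gt0 sqrtr_gt0 lambda_gt0.
suff : [set B : 'M[R]_n | posdefmx B /\ B *m B = invmx A] (Q^T *m diag_mx s *m Q).
  by move=> /(xgetI 0).
have QtQ := mulmx1C QQ; split; first split.
- by rewrite !trmx_mul trmxK tr_diag_mx mulmxA.
- move=> x x0; pose y := x^T *m Q^T.
  have -> : x^T *m (Q^T *m diag_mx s *m Q) *m x = y *m diag_mx s *m y^T.
    by rewrite /y trmx_mul !trmxK !mulmxA.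
  rewrite quad_diag lt_def sumr_ge0 => [|k _]; last first.
    by rewrite mulr_ge0 ?sqr_ge0 ?(ltW (s_gt0 _)).
  rewrite andbT psumr_neq0 => [|k _]; last first.
    by rewrite mulr_ge0 ?sqr_ge0 ?(ltW (s_gt0 _)).
  have /rV0Pn[k yk] : y != 0.
    apply: contra x0 => /eqP y0.
    by rewrite -[x]mul1mx -QtQ -mulmxA -[Q *m x]trmxK trmx_mul -/y y0 trmx0 mulmx0.
  by apply/hasP; exists k; rewrite ?mem_index_enum //= mulr_gt0 // exprn_even_gt0 //= yk.
- have AE : A = Q^T *m diag_mx (\row_i lambda A i) *m Q.
    by rewrite -QAQ !mulmxA QtQ mul1mx -mulmxA QtQ mulmx1.
  suff BBA : Q^T *m diag_mx s *m Q *m (Q^T *m diag_mx s *m Q) *m A = 1%:M.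
    by rewrite -[LHS](mulmxK (posdef_unit posA)) BBA mul1mx.
  rewrite [in X in _ *m X]AE !mulmxA.
  rewrite -[_ *m Q *m Q^T]mulmxA QQ mulmx1 -[_ *m Q *m Q^T]mulmxA QQ mulmx1.
  rewrite -[Q^T *m _ *m _]mulmxA mulmx_diag -[Q^T *m _ *m _]mulmxA mulmx_diag.
  suff -> : (\row_j ((\row_j0 (s 0 j0 * s 0 j0)) 0 j * (\row_i lambda A i) 0 j)) = const_mx 1.
    by rewrite diag_const_mx mulmx1.
  apply/rowP => k; rewrite !mxE -invfM -expr2 sqr_sqrtr ?mulVf // ?gt_eqF ?lambda_gt0 //.
  exact: ltW (lambda_gt0 _ posA).
Qed.

Lemma invsqrtmx_inv n (A : 'M[R]_n) : posdefmx A ->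
  invmx (invsqrtmx A) *m invmx (invsqrtmx A) = A.
Proof.
move=> posA; have [posB BB] := invsqrtmxP posA; set B := invsqrtmx A in posB BB *.
have CCA : invmx B *m invmx B *m invmx A = 1%:M.
  by rewrite -BB mulmxA -(mulmxA (invmx B) _ B) mulVmx ?posdef_unit // mulmx1 mulVmx ?posdef_unit.
by rewrite -[LHS](mulmxKV (posdef_unit posA)) CCA mul1mx.
Qed.

(** The vector is row [b] of [A^{1/2}] divided by its norm, which is [sqrt (A b b)]. *)
Lemma invsqrt_standardize n (A : 'M[R]_n) (b : 'I_n) : posdefmx A ->
  exists u : 'rV[R]_n, \sum_k u 0 k ^+ 2 = 1 /\
  forall z : 'cV[R]_n, \sum_k u 0 k * (invsqrtmx A *m z) k 0 = z b 0 / Num.sqrt (A b b).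
Proof.
move=> posA; have [posB BB] := invsqrtmxP posA; set B := invsqrtmx A in posB BB *.
have uB := posdef_unit posB; have uA := posdef_unit posA.
have CC : invmx B *m invmx B = A by exact: invsqrtmx_inv.
have symCE j k : invmx B j k = invmx B k j by rewrite -[in LHS]posB.1 -trmx_inv mxE.
have A_gt0 := posdef_diag_gt0 b posA.
exists ((Num.sqrt (A b b))^-1 *: row b (invmx B)); split.
  under eq_bigr do rewrite !mxE exprMn.
  rewrite -mulr_sumr exprVn sqr_sqrtr ?(ltW A_gt0) //.
  rewrite -[X in _^-1 * X](_ : A b b = _) ?mulVf ?gt_eqF //.
  rewrite -[in LHS]CC mxE; apply: eq_bigr => k _.
  by rewrite expr2 symCE.
move=> z; transitivity (((Num.sqrt (A b b))^-1 *: row b (invmx B) *m (B *m z)) 0 0).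
  by rewrite mxE.
rewrite -scalemxAl mulmxA -row_mul mulVmx // row1 -rowE.
by rewrite !mxE mulrC.
Qed.

(** Row [a] of [A^{1/2}] has Euclidean norm [sqrt (A a a)], hence no larger entry. *)
Lemma invsqrt_bound n (A : 'M[R]_n) (z : 'cV[R]_n) a : posdefmx A ->
  `|z a 0| <= Num.sqrt (A a a) * \sum_k `|(invsqrtmx A *m z) k 0|.
Proof.
move=> posA; have [posB BB] := invsqrtmxP posA; set B := invsqrtmx A in posB BB *.
have uB := posdef_unit posB; have uA := posdef_unit posA.
have CC : invmx B *m invmx B = A by exact: invsqrtmx_inv.
have symCE j k : invmx B j k = invmx B k j by rewrite -[in LHS]posB.1 -trmx_inv mxE.
have A_gt0 := posdef_diag_gt0 a posA.
have C_le k : `|invmx B a k| <= Num.sqrt (A a a).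
  rewrite -sqrtr_sqr ler_sqrt ?(ltW A_gt0) // -[in leRHS]CC mxE (bigD1 k) //=.
  rewrite [X in _ * X + _]symCE -expr2 lerDl.
  by apply: sumr_ge0 => j _; rewrite [X in _ * X]symCE -expr2 sqr_ge0.
have -> : z = invmx B *m (B *m z) by rewrite mulmxA mulVmx // mul1mx.
rewrite mxE; apply: le_trans (ler_norm_sum _ _ _) _.
rewrite mulr_sumr mulmxA mulmxV // mul1mx.
by apply: ler_sum => k _; rewrite normrM ler_wpM2r.
Qed.

End InvSqrt.

(** * Measurability of eigenvalues *)

Section Measurability.
Context {R : realType}.

(** Inversion is continuous away from 0, and a single point does not matter for
    measurability. *)
Lemma measurable_inv : measurable_fun setT (@GRing.inv R).
Proof.
have -> : [set: R] = [set~ 0] `|` [set 0] by rewrite setUC setUv.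
apply/measurable_funU => //; first exact: measurableC.
split; last exact: measurable_fun_set1.
apply: open_continuous_measurable_fun.
  by rewrite openC; exact: closed_eq.
by move=> x; rewrite inE /= => /eqP x0; exact: inv_continuous.
Qed.

Context d (T : measurableType d).

Lemma measurable_funV_real (f : T -> R) : measurable_fun setT f ->
  measurable_fun setT (fun w => (f w)^-1).
Proof. by move=> mf; apply: measurableT_comp mf; exact: measurable_inv. Qed.

Lemma random_matrix_mul m n p (A : T -> 'M[R]_(m, n)) (B : T -> 'M[R]_(n, p)) :
  random_matrix A -> random_matrix B -> random_matrix (fun w => A w *m B w).
Proof.
move=> mA mB i j; under eq_fun do rewrite mxE.
by apply: measurable_sum => k; apply: measurable_funM; [exact: mA|exact: mB].
Qed.

Lemma random_matrix_tr m n (A : T -> 'M[R]_(m, n)) :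
  random_matrix A -> random_matrix (fun w => (A w)^T).
Proof. by move=> mA i j; under eq_fun do rewrite mxE; exact: mA. Qed.

Lemma random_matrix_cst m n (A : 'M[R]_(m, n)) : random_matrix (fun _ : T => A).
Proof. by move=> i j; exact: measurable_cst. Qed.

Lemma random_matrix_comp d' (T' : measurableType d') (h : T' -> T) m n
    (A : T -> 'M[R]_(m, n)) : measurable_fun setT h ->
  random_matrix A -> random_matrix (A \o h).
Proof. by move=> mh mA i j; exact: (measurableT_comp (mA i j) mh). Qed.

(** By Weyl's inequality the superlevel sets are open among symmetric matrices, hence
    countable unions of boxes with rational centers. *)
Lemma measurable_lambda n (M : T -> 'M[R]_n) i :
  random_matrix M -> (forall w, (M w)^T = M w) ->
  measurable_fun setT (fun w => lambda (M w) i).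
Proof.
move=> mM symM mT; apply: (measurability _ (RGenOInfty.measurableE R)) => //.
move=> /= _ [_ [a ->] <-]; rewrite preimage_itvoy setTI.
pose box (c : 'M[rat]_n * nat) := [set w | forall j k, `|M w j k - ratr (c.1 j k)| < c.2.+1%:R^-1].
pose good (c : 'M[rat]_n * nat) := forall N : 'M[R]_n, N^T = N ->
  (forall j k, `|N j k - ratr (c.1 j k)| < c.2.+1%:R^-1) -> a < lambda N i.
have mbox c : measurable (box c).
  have -> : box c = \bigcap_(jk : 'I_n * 'I_n)
      [set w | `|M w jk.1 jk.2 - ratr (c.1 jk.1 jk.2)| < c.2.+1%:R^-1].
    by apply/seteqP; split=> w wc; [move=> [j k] _; exact: wc|move=> j k; exact: (wc (j, k))].
  apply: fin_bigcap_measurable => [|[j k] _]; first exact: finite_finset.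
  rewrite -[X in measurable X]setTI; apply: measurable_fun_ltr => //.
  by apply: measurableT_comp => //; apply: measurable_funB => //; exact: mM.
rewrite [X in measurable X](_ : _ = \bigcup_c (if `[< good c >] then box c else set0)).
  apply: countable_bigcupT_measurable; first exact: countableP.
  by move=> c; case: ifP.
apply/seteqP; split => [w /= aw|w [c _]]; last first.
  by case: asboolP => // gc wc; apply: gc.
pose e := lambda (M w) i - a.
have e_gt0 : 0 < e by rewrite subr_gt0.
have [k ke] : exists k : nat, 2 * n%:R / e < k.+1%:R.
  exists (Num.truncn (2 * n%:R / e)).
  by apply: truncnS_gt.
have [Q QM] : exists Q : 'M[rat]_n, forall j l, `|M w j l - ratr (Q j l)| < k.+1%:R^-1.
  have ex (x : R) : exists q : rat, `|x - ratr q| < k.+1%:R^-1.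
    have : x - k.+1%:R^-1 < x + k.+1%:R^-1.
      by rewrite ltrBlDr -addrA ltrDl addr_gt0 ?invr_gt0.
    move=> /rat_in_itvoo[q]; rewrite in_itv /= => /andP[q1 q2].
    by exists q; rewrite distrC ltr_distl q1 q2.
  have /choice[f fP] : forall jl : 'I_n * 'I_n, exists q : rat,
      `|M w jl.1 jl.2 - ratr q| < k.+1%:R^-1 by move=> jl; exact: ex.
  by exists (\matrix_(j, l) f (j, l)) => j l; rewrite mxE; exact: (fP (j, l)).
exists (Q, k) => //; case: asboolP => [_|]; first exact: QM.
case=> N symN NQ; have NM j l : `|N j l - M w j l| <= 2 * k.+1%:R^-1.
  rewrite mulr_natl mulr2n (le_trans (ler_distD (ratr (Q j l)) _ _)) //.
  by rewrite lerD ?ltW // distrC QM.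
have := weyl symN (symM w) NM i; rewrite ler_distl => /andP[+ _].
apply: lt_le_trans; rewrite ltrBrDr -ltrBrDl -/e.
by rewrite mulrA ltr_pdivrMr // mulrC [ltRHS]mulrC -ltr_pdivrMr // [n%:R * _]mulrC.
Qed.

End Measurability.

(** * Unit linear forms of the standard normal law *)

Section ProbabilityIntegral.
Context {R : realType} d (T : measurableType d) (P : probability T R).

Lemma integral_prob_cst (r : \bar R) : (\int[P]_w r = r)%E.
Proof.
rewrite integral_cst // -[RHS]mule1; congr (_ * _)%E.
exact: probability_setT.
Qed.

Lemma Rintegral_prob_cst (c : R) : \int[P]_w c = c.
Proof. by rewrite /Rintegral integral_prob_cst. Qed.

End ProbabilityIntegral.

Section GaussianPair.
Context {R : realType}.
Local Notation leb := (@lebesgue_measure R).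
Local Notation gauss := (@normal_prob R 0 1).

Lemma normal_pdf_nzE (a s x : R) : s != 0 ->
  normal_pdf a s x = normal_peak s * expR (- (x - a) ^+ 2 / (s ^+ 2 *+ 2)).
Proof. by move=> s0; rewrite normal_pdfE. Qed.

Lemma integral_gauss_cst (r : \bar R) : (\int[gauss]_x r = r)%E.
Proof. exact: (integral_prob_cst (normal_prob 0 1)). Qed.

(** The density is a Radon-Nikodym derivative, which is unique almost everywhere. *)
Lemma ge0_integral_normal (f : R -> \bar R) (M : R) :
  measurable_fun setT f -> (forall x, 0 <= f x <= M%:E)%E ->
  (\int[gauss]_x f x = \int[leb]_x (f x * (normal_pdf 0 1 x)%:E))%E.
Proof.
move=> mf fM; have dom := normal_prob_dominates 0 (1 : R).
have intf : gauss.-integrable setT f.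
  apply: (@le_integrable _ _ _ _ _ _ _ (EFin \o cst M)) => //.
  - move=> x _ /=; have /andP[f0 fMx] := fM x; rewrite gee0_abs //.
    by rewrite ger0_norm // -lee_fin (le_trans f0).
  - exact: finite_measure_integrable_cst.
rewrite -(Radon_Nikodym_change_of_variables dom) //.
apply: ae_eq_integral => //.
- exact: emeasurable_funM.
- by apply: emeasurable_funM => //; apply/measurable_EFinP; exact: measurable_normal_pdf.
apply: ae_eqe_mul2l; rewrite Radon_NikodymE //=.
case: cid => /= h [h1 h2 h3].
apply: integral_ae_eq => //=.
- by apply/measurable_EFinP; exact: measurable_normal_pdf.
- by move=> E _ mE; rewrite -h3.
Qed.

Lemma ge0_integral_normalR (f : R -> R) (M : R) :
  measurable_fun setT f -> (forall x, 0 <= f x <= M) ->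
  (\int[gauss]_x (f x)%:E = \int[leb]_x (f x * normal_pdf 0 1 x)%:E)%E.
Proof.
move=> mf fM; rewrite (@ge0_integral_normal _ M) //.
- exact/measurable_EFinP.
Qed.

Lemma gauss_reflect (f : R -> R) (M : R) :
  measurable_fun setT f -> (forall x, 0 <= f x <= M) ->
  (\int[gauss]_x (f (- x))%:E = \int[gauss]_x (f x)%:E)%E.
Proof.
move=> mf fM.
have mfN : measurable_fun setT (fun x : R => f (- x)).
  by apply: measurableT_comp mf _; exact: oppr_measurable.
rewrite (ge0_integral_normalR mfN (fun x => fM (- x))) (ge0_integral_normalR mf fM).
pose g x : \bar R := (f x * normal_pdf 0 1 x)%:E.
have -> : (fun x => (f (- x) * normal_pdf 0 1 x)%:E) = g \o (-%R).
  apply/funext => x; rewrite /g /=; congr (_ * _)%:E.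
  by rewrite !normal_pdf_nzE ?oner_neq0 // !subr0 sqrrN.
transitivity (\int[leb]_(x in (-%R : R -> measurableTypeR R) @^-1` setT)
    (g \o (-%R : R -> measurableTypeR R)) x)%E; first by rewrite preimage_setT.
rewrite -ge0_integral_pushforward //.
- by apply: eq_measure_integral => A mA _; exact: lebesgue_measureN.
- by apply/measurable_EFinP/measurable_funM => //; exact: measurable_normal_pdf.
- move=> x _; rewrite lee_fin mulr_ge0 ?normal_pdf_ge0 //.
  by have /andP[] := fM x.
Qed.

(** The random variable [a + b Y] has density [normal_pdf a b] when [Y] is standard
    normal. *)
Lemma gauss_affine (f : R -> R) (M a b : R) : 0 < b ->
  continuous f -> (forall x, 0 <= f x <= M) ->
  (\int[gauss]_y (f (a + b * y))%:E = \int[leb]_z (f z * normal_pdf a b z)%:E)%E.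
Proof.
move=> b0 cf fM; pose F (y : R^o) : R^o := a + b * y.
have cF : continuous F by move=> x; apply: cvgD; [exact: cvg_cst|exact: mulrl_continuous].
have F'E : F^`()%classic = cst b.
  apply/funext => x; rewrite /F derive1E deriveD // derive_cst add0r deriveM //.
  by rewrite derive_id derive_cst scaler0 addr0 scaler1.
have mfF : measurable_fun setT (fun y => f (F y)).
  by apply: continuous_measurable_fun => x; apply: continuous_comp; [exact: cF|exact: cf].
rewrite (ge0_integral_normalR mfF (fun x => fM (F x))).
rewrite (@increasing_ge0_integration_by_substitutionT _ F (fun z => f z * normal_pdf a b z)).
- apply: eq_integral => y _; rewrite F'E /= !fctE /= -mulrA; congr (_ * _)%:E.
  rewrite !normal_pdf_nzE ?oner_neq0 ?gt_eqF // /normal_peak !subr0.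
  have -> : - (F y - a) ^+ 2 / (b ^+ 2 *+ 2) = - y ^+ 2 / (1 ^+ 2 *+ 2).
    by rewrite /F; field; rewrite gt_eqF.
  rewrite [RHS]mulrAC; congr (_ * _).
  have -> : b ^+ 2 * pi *+ 2 = b ^+ 2 * (1 ^+ 2 * pi *+ 2).
    by rewrite expr1n mul1r mulrnAr.
  by rewrite sqrtrM ?sqr_ge0 // sqrtr_sqr gtr0_norm // invfM [RHS]mulrAC mulVf ?mul1r ?gt_eqF.
- by move=> x y xy; rewrite /F ltrD2l ltr_pM2l.
- by rewrite F'E; move=> ?; exact: cvg_cst.
- by rewrite F'E; exact: is_cvg_cst.
- by rewrite F'E; exact: is_cvg_cst.
- by move=> x; apply: derivableD => //; apply: derivableM.
- apply/cvgrNyPle => A; apply: filterS (nbhs_ninfty_le (num_real ((A - a) / b))) => y.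
  by rewrite ler_pdivlMr // lerBrDl mulrC.
- apply/cvgryPge => A; apply: filterS (nbhs_pinfty_ge (num_real ((A - a) / b))) => y.
  by rewrite ler_pdivrMr // lerBlDl mulrC.
- move=> x; apply: cvgM; first exact: cf.
  by apply: continuous_normal_pdf; rewrite gt_eqF.
- by move=> x; rewrite mulr_ge0 ?normal_pdf_ge0 //; have /andP[] := fM x.
Qed.

(** Rotation invariance of the plane Gaussian measure, tested on functions of one
    coordinate. *)
Lemma gauss_pair_unit (f : R -> R) (M a b : R) : 0 <= b -> a ^+ 2 + b ^+ 2 = 1 ->
  continuous f -> (forall x, 0 <= f x <= M) ->
  (\int[gauss]_x \int[gauss]_y (f (a * x + b * y))%:E = \int[gauss]_x (f x)%:E)%E.
Proof.
move=> b_ge0 ab cf fM.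
have f0 x : 0 <= f x by have /andP[] := fM x.
have mf : measurable_fun setT f by exact: continuous_measurable_fun.
have [b0|b_neq0] := eqVneq b 0.
  have const x : (\int[gauss]_y (f (a * x + b * y))%:E = (f (a * x))%:E)%E.
    have -> : (fun y => (f (a * x + b * y))%:E) = cst (f (a * x))%:E.
      by apply/funext => y; rewrite b0 mul0r addr0.
    by rewrite integral_gauss_cst.
  under eq_integral do rewrite const.
  have : a ^+ 2 == 1 by rewrite -ab b0 expr0n addr0.
  rewrite sqrf_eq1 => /orP[] /eqP ->; first by under eq_integral do rewrite mul1r.
  by under eq_integral do rewrite mulN1r; exact: gauss_reflect fM.
have b_gt0 : 0 < b by rewrite lt_def b_neq0.
(* with [x] fixed, [a x + b Y] has density [normal_pdf (a x) b]; exchange the two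
   integrals and complete the square *)
pose h (xz : R * R) : R := f xz.2 * normal_pdf (a * xz.1) b xz.2.
have mpdf : measurable_fun setT (fun xz : R * R => normal_pdf (a * xz.1) b xz.2).
  under eq_fun do rewrite normal_pdf_nzE //.
  apply: measurable_funM => //; apply: measurableT_comp => //; apply: measurable_funM => //.
  apply: measurableT_comp => //; apply: measurable_funX; apply: measurable_funB => //.
  by apply: measurable_funM.
have mh : measurable_fun setT h.
  by apply: measurable_funM => //; exact: measurableT_comp.
have h0 xz : 0 <= h xz by rewrite mulr_ge0 ?normal_pdf_ge0.
have innerE x : (\int[gauss]_y (f (a * x + b * y))%:E = \int[leb]_z (h (x, z))%:E)%E.
  exact: gauss_affine fM.
have inner_bound x : (0 <= \int[leb]_z (h (x, z))%:E <= M%:E)%E.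
  rewrite -innerE; apply/andP; split; first by apply: integral_ge0 => y _; rewrite lee_fin.
  apply: (@le_trans _ _ (\int[gauss]_y (cst M%:E y))%E).
    apply: ge0_le_integral => //.
    - by move=> y _; rewrite lee_fin.
    - apply/measurable_EFinP; apply: measurableT_comp => //.
      by apply: measurable_funD => //; apply: measurable_funM.
    - by move=> y _; rewrite lee_fin; have /andP[] := fM (a * x + b * y).
  by rewrite integral_gauss_cst.
under eq_integral do rewrite innerE.
rewrite (ge0_integral_normal _ inner_bound); last first.
  apply: (measurable_fun_fubini_tonelli_F (m2 := leb) (EFin \o h)) => [|xz].
    by apply/measurable_EFinP; exact: mh.
  by rewrite lee_fin.
pose k (xz : R * R) : R := h xz * normal_pdf 0 1 xz.1.
have mk : measurable_fun setT k.
  apply: measurable_funM => //; apply: measurableT_comp => //.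
  exact: measurable_normal_pdf.
transitivity (\int[leb]_x \int[leb]_z (EFin \o k) (x, z))%E.
  apply: eq_integral => x _; rewrite -ge0_integralZr //.
  - by apply/measurable_EFinP; exact: measurableT_comp.
  - by move=> z _; rewrite lee_fin.
  - by rewrite lee_fin normal_pdf_ge0.
rewrite fubini_tonelli //; last 2 first.
- exact/measurable_EFinP.
- by move=> xz; rewrite lee_fin mulr_ge0 ?normal_pdf_ge0.
rewrite (ge0_integral_normalR mf fM); apply: eq_integral => z _.
have kE x : k (x, z) = f z * normal_pdf 0 1 z * normal_pdf (a * z) b x.
  rewrite /k /h /= -!mulrA; congr (_ * _); rewrite !normal_pdf_nzE ?oner_neq0 //.
  rewrite mulrACA [RHS]mulrACA [normal_peak 1 * _]mulrC; congr (_ * _).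
  rewrite -!expRD; congr expR.
  have bE : b ^+ 2 = 1 - a ^+ 2 by rewrite -ab addrC addKr.
  have nz : 1 - a ^+ 2 != 0 by rewrite -bE sqrf_eq0.
  by rewrite bE; field.
under eq_integral do rewrite /= kE EFinM.
rewrite ge0_integralZl //.
- by rewrite integral_normal_pdf mule1.
- by apply/measurable_EFinP; exact: measurable_normal_pdf.
- by move=> x _; rewrite lee_fin normal_pdf_ge0.
- by rewrite lee_fin mulr_ge0 ?normal_pdf_ge0.
Qed.

(** Two independent centered normal variables add up to a normal variable whose
    variance is the sum. *)
Lemma gauss_pair (f : R -> R) (M a b : R) : 0 <= b ->
  continuous f -> (forall x, 0 <= f x <= M) ->
  (\int[gauss]_x \int[gauss]_y (f (a * x + b * y))%:E =
   \int[gauss]_x (f (Num.sqrt (a ^+ 2 + b ^+ 2) * x))%:E)%E.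
Proof.
move=> b0 cf fM; set r := Num.sqrt _.
have [r0|r_neq0] := eqVneq r 0.
  move/eqP: r0; rewrite sqrtr_eq0 le_eqVlt ltNge addr_ge0 ?sqr_ge0 // orbF.
  rewrite paddr_eq0 ?sqr_ge0 // !sqrf_eq0 => /andP[/eqP a0 /eqP b0'].
  have r0 : r = 0 by rewrite /r a0 b0' expr0n addr0 sqrtr0.
  have E1 : (fun x => (f (r * x))%:E) = cst (f 0)%:E.
    by apply/funext => x; rewrite r0 mul0r.
  have E2 x : (fun y => (f (a * x + b * y))%:E) = cst (f 0)%:E.
    by apply/funext => y; rewrite a0 b0' !mul0r addr0.
  rewrite E1; under eq_integral do rewrite E2 integral_gauss_cst.
  by [].
have r_gt0 : 0 < r by rewrite lt_def r_neq0 sqrtr_ge0.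
rewrite -(@gauss_pair_unit (fun z => f (r * z)) M (a / r) (b / r)) //.
- apply: eq_integral => x _; apply: eq_integral => y _; congr (f _)%:E.
  by field.
- by rewrite divr_ge0 // ltW.
- rewrite !exprMn exprVn -mulrDl /r sqr_sqrtr ?addr_ge0 ?sqr_ge0 // mulfV //.
  by apply: contra r_neq0 => /eqP E; rewrite /r E sqrtr0.
- by move=> x; apply: continuous_comp; [exact: mulrl_continuous|exact: cf].
Qed.

End GaussianPair.

Section StdNormal.
Context {R : realType}.
Local Notation gauss := (@normal_prob R 0 1).

Lemma measurable_linear_tuple n (u : 'rV[R]_n) :
  measurable_fun setT (fun t : n.-tuple R => \sum_k u 0 k * tnth t k).
Proof.
apply: measurable_sum => k; apply: measurable_funM => //.
exact: measurable_tnth.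
Qed.

(** The recursive definition of [std_normal] splits off one coordinate at a time, and
    each step adds two independent normal variables. *)
Lemma std_normal_linear n (u : 'rV[R]_n) (f : R -> R) (M : R) :
  continuous f -> (forall x, 0 <= f x <= M) ->
  (\int[std_normal n]_t (f (\sum_k u 0 k * tnth t k))%:E =
   \int[gauss]_x (f (Num.sqrt (\sum_k u 0 k ^+ 2) * x))%:E)%E.
Proof.
elim: n u f => [|n IHn] u f cf fM.
  have E : (fun t : 0.-tuple R => (f (\sum_(k < 0) u 0 k * tnth t k))%:E) = cst (f 0)%:E.
    by apply/funext => t; rewrite big_ord0.
  have -> : (\int[std_normal 0]_t (f (\sum_(k < 0) u 0 k * tnth t k))%:E)%E = (f 0)%:E.
    by rewrite E; exact: (integral_prob_cst (std_normal 0)).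
  rewrite big_ord0 sqrtr0.
  have -> : (fun x => (f (0 * x))%:E) = cst (f 0)%:E.
    by apply/funext => x; rewrite mul0r.
  by rewrite integral_gauss_cst.
pose u' : 'rV[R]_n := \row_k u 0 (lift ord0 k).
have mf : measurable_fun setT f by exact: continuous_measurable_fun.
have f0 x : 0 <= f x by have /andP[] := fM x.
have mfu : measurable_fun setT (fun t : n.+1.-tuple R => f (\sum_k u 0 k * tnth t k)).
  by apply: measurableT_comp => //; exact: measurable_linear_tuple.
rewrite /= ge0_integral_distribution; last 2 first.
- exact/measurable_EFinP.
- by move=> t; rewrite lee_fin.
rewrite fubini_tonelli1 /=; last 2 first.
- apply/measurable_EFinP; apply: measurableT_comp mfu _.
  exact: measurable_tuple_cons.
- by move=> t; rewrite lee_fin.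
transitivity (\int[gauss]_x \int[gauss]_y
   (f (u 0 ord0 * x + Num.sqrt (\sum_k u' 0 k ^+ 2) * y))%:E)%E; last first.
  rewrite (@gauss_pair _ f M) // sqr_sqrtr; last by apply: sumr_ge0 => k _; exact: sqr_ge0.
  rewrite big_ord_recl /=; apply: eq_integral => x _; congr (f (Num.sqrt (_ + _) * _))%:E.
  by apply: eq_bigr => k _; rewrite mxE.
apply: eq_integral => x _.
rewrite -(IHn u' (fun z => f (u 0 ord0 * x + z))); last 2 first.
- by move=> z; apply: continuous_comp; [apply: cvgD; [exact: cvg_cst|exact: cvg_id]|exact: cf].
- by [].
apply: eq_integral => t _; rewrite /fubini_F /= big_ord_recl; congr (f (_ + _))%:E.
by apply: eq_bigr => k _; rewrite mxE tnthS.
Qed.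

End StdNormal.

(** * Slutsky's theorem along moving linear forms *)

Section BoundedExpectation.
Context {R : realType} d (T : measurableType d) (P : probability T R).

Lemma bounded_integrable (X : T -> R) (M : R) :
  measurable_fun setT X -> (forall w, `|X w| <= M) -> P.-integrable setT (EFin \o X).
Proof.
move=> mX XM; apply: (@le_integrable _ _ _ _ _ _ _ (EFin \o cst M)) => //.
- exact/measurable_EFinP.
- by move=> w _ /=; rewrite lee_fin (le_trans (XM w)) // ler_norm.
- exact: finite_measure_integrable_cst.
Qed.

Lemma expectation_Rintegral (X : T -> R) (M : R) :
  measurable_fun setT X -> (forall w, `|X w| <= M) ->
  'E_P[X]%E = (\int[P]_w X w)%:E.
Proof.
move=> mX XM; rewrite unlock /Rintegral fineK //.
exact/integrable_fin_num/bounded_integrable.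
Qed.

(** Off [A] the variables differ by [e]; on [A] by at most [2 M], with probability at
    most [e]. *)
Lemma expectation_close (X Y : T -> R) (A : set T) (M e : R) :
  measurable_fun setT X -> measurable_fun setT Y ->
  (forall w, `|X w| <= M) -> (forall w, `|Y w| <= M) ->
  measurable A -> (P A <= e%:E)%E -> (forall w, ~ A w -> `|X w - Y w| <= e) ->
  `|\int[P]_w X w - \int[P]_w Y w| <= e + 2 * M * e.
Proof.
move=> mX mY XM YM mA PA XY.
have iX := bounded_integrable mX XM; have iY := bounded_integrable mY YM.
have [w0 _] : [set: T] !=set0.
  apply/set0P/eqP => T0; have := probability_setT P.
  by rewrite T0 measure0 => /eqP; rewrite eq_sym onee_eq0.
have M0 : 0 <= M by rewrite (le_trans _ (XM w0)).
have e0 : 0 <= e by rewrite -lee_fin (le_trans _ PA).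
have XYM w : `|X w - Y w| <= M + M by rewrite (le_trans (ler_normB _ _)) // lerD.
have mXY : measurable_fun setT (fun w => X w - Y w) by exact: measurable_funB.
rewrite -RintegralB //; apply: (le_trans (le_normr_Rintegral _ _)) => //.
  exact: bounded_integrable XYM.
have mI : measurable_fun setT (fun w => 2 * M * \1_A w : R).
  by apply: measurable_funM => //; exact: measurable_indic.
have iI : P.-integrable setT (EFin \o (fun w => 2 * M * \1_A w : R)).
  apply: (bounded_integrable mI (M := 2 * M)) => w.
  rewrite indicE; case: (_ \in _); rewrite ?mulr1 ?mulr0 ?normr0 ?mulr_ge0 //.
  by rewrite ger0_norm // mulr_ge0.
apply: (@le_trans _ _ (\int[P]_w (e + 2 * M * \1_A w))).
  apply: le_Rintegral => //.
  - apply: (bounded_integrable (M := M + M)); first exact: measurableT_comp.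
    by move=> w; rewrite normr_id.
  - apply: (bounded_integrable (M := e + 2 * M)); first exact: measurable_funD.
    move=> w; rewrite indicE ger0_norm ?addr_ge0 ?mulr_ge0 // lerD2l.
    by case: (_ \in _); rewrite ?mulr1 ?mulr0 ?mulr_ge0.
  - move=> w _; rewrite indicE; case: (boolP (w \in A)) => [_|/negP wA].
      by rewrite mulr1 (le_trans (XYM w)) //; move: e0; lra.
    by rewrite mulr0 addr0 XY // => ?; apply: wA; rewrite inE.
rewrite RintegralD //; last exact: finite_measure_integrable_cst.
rewrite Rintegral_prob_cst lerD2l.
rewrite RintegralZl //; last first.
  apply: (bounded_integrable (M := 1)); first exact: measurable_indic.
  by move=> w; rewrite indicE; case: (_ \in _); rewrite ?normr1 ?normr0.
rewrite ler_wpM2l ?mulr_ge0 // /Rintegral integral_indic // setIT.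
by rewrite -lee_fin fineK // fin_num_measure.
Qed.

Lemma Rintegral_bound (X : T -> R) (M : R) :
  measurable_fun setT X -> (forall w, `|X w| <= M) -> `|\int[P]_w X w| <= M.
Proof.
move=> mX XM; apply: (le_trans (le_normr_Rintegral _ _)) => //.
  exact: bounded_integrable XM.
rewrite -[leRHS](Rintegral_prob_cst P); apply: le_Rintegral => //.
  by apply: (bounded_integrable (M := M)) => [|w]; [exact: measurableT_comp|rewrite normr_id].
exact: finite_measure_integrable_cst.
Qed.

End BoundedExpectation.

Section UniformContinuity.
Context {R : realType}.

(** Heine's theorem; only one of the two points is required to lie in the segment. *)
Lemma continuous_near_segment (f : R -> R) (B e : R) : continuous f -> 0 < e ->
  exists2 dl, 0 < dl & forall x y, `|x| <= B -> `|x - y| <= dl -> `|f x - f y| <= e.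
Proof.
move=> cf e0.
have /compact_near_coveringP seg := @segment_compact R (- B) B.
have : \forall dl \near 0^'+, `[- B, B]%classic `<=`
    [set x | forall y, `|x - y| <= dl -> `|f x - f y| <= e].
  apply: seg => x0 _.
  have /cvgrPdist_le/(_ (e / 2)) := cf x0; rewrite divr_gt0 // => /(_ isT).
  move=> /nbhs_ballP[r /= r0 fr].
  have r20 : 0 < r / 2 by rewrite divr_gt0.
  near=> x dl => y xy.
  have x0x : `|x0 - x| < r / 2.
    by near: x; exact: nbhsx_ballx.
  have dlr : dl < r / 2.
    by near: dl; exact: nbhs_right_lt.
  rewrite (le_trans (ler_distD (f x0) _ _)) // [leRHS]splitr lerD //.
    rewrite distrC; apply: fr; rewrite /ball /= (lt_trans x0x) //.
    by rewrite ltr_pdivrMr // ltr_pMr // ltr1n.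
  apply: fr; rewrite /ball /= [ltRHS]splitr (le_lt_trans (ler_distD x _ _)) //.
  by rewrite ltr_leD // (le_trans xy) // ltW.
move=> near_dl.
have [dl [dl0 dlP]] : exists dl : R, 0 < dl /\ (`[- B, B]%classic `<=`
    [set x | forall y, `|x - y| <= dl -> `|f x - f y| <= e]).
  have : \forall dl \near 0^'+, 0 < dl /\ (`[- B, B]%classic `<=`
    [set x | forall y, `|x - y| <= dl -> `|f x - f y| <= e]).
    by near=> dl; split; [near: dl; exact: nbhs_right_gt|near: dl].
  by move=> /filter_ex.
exists dl => // x y xB xy; apply: dlP => //=.
by rewrite in_itv /= -ler_norml.
Unshelve. all: by end_near. Qed.

End UniformContinuity.

Lemma continuous_bigsum {R : realType} (T : topologicalType) (I : Type) (s : seq I)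
    (F : I -> T -> R) :
  (forall k, continuous (F k)) -> continuous (fun x => \sum_(k <- s) F k x).
Proof.
move=> cF; elim: s => [|k s IHs] x.
  by under eq_fun do rewrite big_nil; exact: cvg_cst.
under eq_fun do rewrite big_cons.
by apply: cvgD; [exact: cF|exact: IHs].
Qed.

Section Slutsky.
Context {R : realType} d (T : measurableType d) (P : probability T R).
Local Notation gauss := (@normal_prob R 0 1).

Definition linform h (v : 'rV[R]_h) (x : 'cV[R]_h) : R := \sum_k v 0 k * x k 0.
Definition l1norm h (x : 'cV[R]_h) : R := \sum_k `|x k 0|.

Lemma continuous_linform h (v : 'rV[R]_h) : continuous (linform v).
Proof.
apply: continuous_bigsum => k x.
apply: (@continuous_comp _ _ _ (fun y : 'cV[R]_h => y k 0) ( *%R (v 0 k))).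
  exact: coord_continuous.
exact: mulrl_continuous.
Qed.

Lemma continuous_l1norm h : continuous (@l1norm h).
Proof.
apply: continuous_bigsum => k x.
apply: (@continuous_comp _ _ _ (fun y : 'cV[R]_h => y k 0) (@Num.norm _ R)).
  exact: coord_continuous.
exact: norm_continuous.
Qed.

Lemma linform_le h (v : 'rV[R]_h) (x : 'cV[R]_h) (c : R) :
  (forall k, `|v 0 k| <= c) -> `|linform v x| <= c * l1norm x.
Proof.
move=> vc; apply: le_trans (ler_norm_sum _ _ _) _; rewrite mulr_sumr.
by apply: ler_sum => k _; rewrite normrM ler_wpM2r.
Qed.

Lemma unit_coord_le1 h (v : 'rV[R]_h) k : \sum_k v 0 k ^+ 2 = 1 -> `|v 0 k| <= 1.
Proof.
move=> v1; rewrite -[leRHS]sqrtr1 -sqrtr_sqr ler_wsqrtr // -v1 (bigD1 k) //= lerDl.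
by apply: sumr_ge0 => j _; exact: sqr_ge0.
Qed.

Lemma compact_sphere h : compact [set v : 'rV[R]_h | \sum_k v 0 k ^+ 2 = 1].
Proof.
apply: (@subclosed_compact _ _ [set v : 'rV[R]_h | forall k, v ord0 k \in `[-1, 1]]).
- have -> : [set v : 'rV[R]_h | \sum_k v 0 k ^+ 2 = 1] =
    (fun v : 'rV[R]_h => \sum_k v 0 k ^+ 2) @^-1` [set x | x = 1] by [].
  apply: preimage_closed; last exact: closed_eq.
  move=> v _; apply: continuous_bigsum => k x.
  apply: (@continuous_comp _ _ _ (fun y : 'rV[R]_h => y 0 k) (fun t : R => t ^+ 2)).
    exact: coord_continuous.
  exact: exprn_continuous.
- apply: (@rV_compact R h (fun=> `[(-1 : R), 1]%classic)).
  by move=> _; apply: segment_compact.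
- by move=> v v1 k; rewrite in_itv /= -ler_norml unit_coord_le1.
Qed.

Context h (W : nat -> T -> 'cV[R]_h).
Hypothesis mW : forall n k, measurable_fun setT (fun w => W n w k 0).
Hypothesis W_law : cvg_in_law P (std_normal h) W (@col_of_tuple R h).

Lemma measurable_linform n v : measurable_fun setT (fun w => linform v (W n w)).
Proof. by apply: measurable_sum => k; apply: measurable_funM. Qed.

Lemma measurable_l1norm n : measurable_fun setT (fun w => l1norm (W n w)).
Proof. by apply: measurable_sum => k; apply: measurableT_comp. Qed.

Lemma W_law_real (F : 'cV[R]_h -> R) (M : R) :
  continuous F -> (forall x, `|F x| <= M) ->
  (forall n, measurable_fun setT (fun w => F (W n w))) ->
  measurable_fun setT (fun t => F (@col_of_tuple R h t)) ->
  \int[P]_w F (W n w) @[n --> \oo] --> \int[std_normal h]_t F (col_of_tuple t).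
Proof.
move=> cF FM mFW mFt.
have := W_law cF (ex_intro _ M FM).
rewrite (expectation_Rintegral _ (M := M) mFt) // => /fine_cvg; apply: cvg_trans.
apply: near_eq_cvg; near=> n; rewrite /=.
by rewrite (expectation_Rintegral _ (M := M) (mFW n)).
Unshelve. all: by end_near. Qed.

(** The continuous mapping theorem for a fixed unit linear form. *)
Lemma cvg_linform (f : R -> R) (M : R) (v : 'rV[R]_h) :
  continuous f -> (forall x, `|f x| <= M) -> \sum_k v 0 k ^+ 2 = 1 ->
  \int[P]_w f (linform v (W n w)) @[n --> \oo] --> \int[gauss]_x f x.
Proof.
move=> cf fM v1.
have mf : measurable_fun setT f by exact: continuous_measurable_fun.
have linE t : linform v (@col_of_tuple R h t) = \sum_k v 0 k * tnth t k.
  by apply: eq_bigr => k _; rewrite mxE.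
have mft : measurable_fun setT (fun t => f (linform v (@col_of_tuple R h t))).
  under eq_fun do rewrite linE.
  by apply: measurableT_comp => //; exact: measurable_linear_tuple.
have -> : \int[gauss]_x f x = \int[std_normal h]_t f (linform v (col_of_tuple t)).
  (* [std_normal_linear] is about nonnegative functions *)
  have cg : continuous (fun x => f x + M) by move=> x; apply: cvgD; [exact: cf|exact: cvg_cst].
  have gM x : 0 <= f x + M <= M + M.
    by have /ler_normlP[f1 f2] := fM x; rewrite lerD2r f2 -lerBlDr sub0r lerNl f1.
  have := std_normal_linear v cg gM; rewrite v1 sqrtr1.
  have -> : (fun x => (f (1 * x) + M)%:E) = (fun x => (f x + M)%:E).
    by apply/funext => x; rewrite mul1r.
  under eq_fun do rewrite -linE.
  move/(congr1 fine).
  have fMg : gauss.-integrable setT (EFin \o f) by exact: (bounded_integrable (@normal_prob R 0 1) mf fM).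
  have fMn : (std_normal h).-integrable setT
    (EFin \o (fun t => f (linform v (@col_of_tuple R h t)))).
    exact: bounded_integrable _ mft (fun t => fM _).
  rewrite -![fine _]/(Rintegral _ _ _).
  rewrite RintegralD //; last exact: finite_measure_integrable_cst.
  rewrite RintegralD //; last exact: finite_measure_integrable_cst.
  by rewrite !Rintegral_prob_cst => /addIr.
apply: (@W_law_real (f \o linform v) M) => //.
- by move=> x; apply: continuous_comp; [exact: continuous_linform|exact: cf].
- by move=> x; exact: fM.
- move=> n.
  exact: (measurableT_comp mf (measurable_linform n v)).
Qed.

(** Weak convergence to a fixed law implies tightness: test it on continuous cutoffs
    whose integral against the limit law is small. *)
Lemma tight (e : R) : 0 < e ->
  exists K : R, 0 <= K /\
    \forall n \near \oo, (P [set w | (K < l1norm (W n w))%R] <= e%:E)%E.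
Proof.
move=> e0.
(* a continuous function between the indicators of [K + 1 <= |x|] and [K < |x|] *)
pose g (K : nat) (x : 'cV[R]_h) : R := Num.min 1 (Num.max 0 (l1norm x - K%:R)).
have g01 K x : 0 <= g K x <= 1.
  by rewrite /g le_min ler01 le_max lexx /= ge_min lexx.
have g1 K x : `|g K x| <= 1 by have /andP[g0 ?] := g01 K x; rewrite ger0_norm.
have cg K : continuous (g K).
  move=> x; apply: (@continuous_min _ _ (cst 1) (fun y => Num.max 0 (l1norm y - K%:R)));
    first by exact: cst_continuous.
  apply: (@continuous_max _ _ (cst 0) (fun y => l1norm y - K%:R));
    first by exact: cst_continuous.
  exact: (cvgB (@continuous_l1norm h x) (cvg_cst _)).
have mg d' (T' : measurableType d') (X : T' -> 'cV[R]_h) K :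
    measurable_fun setT (fun w => l1norm (X w)) -> measurable_fun setT (fun w => g K (X w)).
  move=> mX; apply: measurable_minr => //; apply: measurable_maxr => //.
  exact: measurable_funB.
have mt : measurable_fun setT (fun t => l1norm (@col_of_tuple R h t)).
  apply: measurable_sum => k; apply: measurableT_comp => //.
  under eq_fun do rewrite mxE; exact: measurable_tnth.
have lim0 : \int[std_normal h]_t g K (col_of_tuple t) @[K --> \oo] --> (0 : R).
  have [|||||_ _] := @dominated_convergence _ _ _ (std_normal h) setT measurableT
    (fun K t => (g K (col_of_tuple t))%:E) (cst 0%E) (cst 1%E).
  - by move=> K; apply/measurable_EFinP; exact: mg.
  - exact: measurable_cst.
  - apply: aeW => t _; apply: cvg_near_cst; near=> K.
    rewrite /g (_ : Num.max 0 _ = 0) ?min_r //; apply/max_idPl; rewrite subr_le0.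
    by near: K; exact: nbhs_infty_ger.
  - exact: finite_measure_integrable_cst.
  - by apply: aeW => t K _ /=; rewrite lee_fin.
  by rewrite /= integral0 => /fine_cvg.
have /cvgrPdist_lt/(_ e e0) := lim0; move=> [K _ /(_ K (leqnn K))] /= gK.
exists K.+1%:R; split => //.
have cvgW := @W_law_real (g K) 1 (cg K) (g1 K) (fun n => mg _ _ (W n) K (measurable_l1norm n))
   (mg _ _ _ K mt).
move: gK; rewrite sub0r normrN => /ltr_normlW gK.
have gap : 0 < e - \int[std_normal h]_t g K (col_of_tuple t) by rewrite subr_gt0.
have /cvgrPdist_lt/(_ _ gap) := cvgW; apply: filterS => n gn.
have gWn : \int[P]_w g K (W n w) <= e.
  move: gn; rewrite distrC => /ltr_normlW; rewrite ltrD2r; exact: ltW.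
have mA : measurable [set w | K.+1%:R < l1norm (W n w)].
  rewrite -[X in measurable X]setTI; apply: measurable_fun_ltr => //.
  exact: measurable_l1norm.
have mgW := mg _ _ (W n) K (measurable_l1norm n).
have <- := expectation_indic P mA.
apply: (@le_trans _ _ 'E_P[fun w => g K (W n w)]%E); last first.
  by rewrite (expectation_Rintegral _ (M := 1)).
apply: expectation_le => //.
- by move=> w; have /andP[] := g01 K (W n w).
- apply: aeW => w; rewrite indicE; case: (boolP (w \in _)) => [|_]; last first.
    by have /andP[] := g01 K (W n w).
  rewrite inE /= => Kw; rewrite /g le_min lexx /= le_max; apply/orP; right.
  by rewrite lerBrDr addrC natr1 ltW.
Unshelve. all: by end_near. Qed.

End Slutsky.

Section SlutskyTheorem.
Context {R : realType} d (T : measurableType d) (P : probability T R).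
Local Notation gauss := (@normal_prob R 0 1).
Context h (W : nat -> T -> 'cV[R]_h).
Hypothesis mW : forall n k, measurable_fun setT (fun w => W n w k 0).
Hypothesis W_law : cvg_in_law P (std_normal h) W (@col_of_tuple R h).

Lemma linformB (u v : 'rV[R]_h) x : linform u x - linform v x = linform (u - v) x.
Proof. by rewrite /linform -sumrB; apply: eq_bigr => k _; rewrite !mxE mulrBl. Qed.

Lemma measurable_l1_gt n (K : R) : measurable [set w | K < l1norm (W n w)].
Proof.
rewrite -[X in measurable X]setTI; apply: measurable_fun_ltr => //.
exact: measurable_l1norm.
Qed.

(** Convergence at each point of the sphere and equicontinuity, which comes from
    tightness and Heine's theorem, give uniform convergence because the sphere is
    compact. *)
Lemma uniform_linform (f : R -> R) (M e : R) :
  continuous f -> (forall x, `|f x| <= M) -> 0 < e ->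
  \forall n \near \oo, forall v : 'rV[R]_h, \sum_k v 0 k ^+ 2 = 1 ->
    `|\int[P]_w f (linform v (W n w)) - \int[gauss]_x f x| <= e + 2 * M * e + e.
Proof.
move=> cf fM e0.
have mf : measurable_fun setT f by exact: continuous_measurable_fun.
have mfW n v : measurable_fun setT (fun w => f (linform v (W n w))).
  by apply: measurableT_comp => //; exact: measurable_linform.
have [K [K0 tightK]] := tight mW W_law e0.
have [dl dl0 fdl] := continuous_near_segment K cf e0.
have /compact_near_coveringP sph := @compact_sphere R h.
apply: (sph _ \oo (fun n v =>
  `|\int[P]_w f (linform v (W n w)) - \int[gauss]_x f x| <= e + 2 * M * e + e)).
move=> v0 v01.
have /cvgrPdist_le/(_ e e0) cvg0 := cvg_linform mW W_law cf fM v01.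
pose r := dl / (K + 1).
have r0 : 0 < r by rewrite divr_gt0 // ltr_wpDl.
near=> v n.
have v0v k : `|v0 0 k - v 0 k| <= r.
  have : ball v0 r v by near: v; exact: nbhsx_ballx.
  by move=> [_ vb]; have := vb 0 k; exact: ltW.
have cvgn : `|\int[P]_w f (linform v0 (W n w)) - \int[gauss]_x f x| <= e.
  by rewrite distrC; near: n.
have tightn : (P [set w | (K < l1norm (W n w))%R] <= e%:E)%E by near: n.
rewrite (le_trans (ler_distD (\int[P]_w f (linform v0 (W n w))) _ _)) // lerD //.
apply: (expectation_close _ _ _ _ (measurable_l1_gt n K)) => // w /negP.
rewrite -leNgt => wK; rewrite distrC; apply: fdl.
  have /le_trans : `|linform v0 (W n w)| <= 1 * l1norm (W n w).
    by apply: linform_le => k; exact: unit_coord_le1.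
  by apply; rewrite mul1r.
rewrite linformB (le_trans (linform_le _ (c := r) _)) //.
  by move=> k; rewrite !mxE.
rewrite /r mulrAC ler_pdivrMr ?ltr_wpDl // ler_wpM2l ?(ltW dl0) //.
by rewrite (le_trans wK) // lerDl.
Unshelve. all: by end_near. Qed.

(** The directions [u n] may vary without converging, and [Y] has to be close to the
    linear form only where [W] is bounded. *)
Lemma slutsky_linform (u : nat -> 'rV[R]_h) (Y : nat -> T -> R) :
  (forall n, measurable_fun setT (Y n)) ->
  (\forall n \near \oo, \sum_k u n 0 k ^+ 2 = 1) ->
  (forall K eta, 0 < eta -> \forall n \near \oo, forall w,
     l1norm (W n w) <= K -> `|Y n w - linform (u n) (W n w)| <= eta) ->
  forall (f : R -> R) (M : R), continuous f -> (forall x, `|f x| <= M) ->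
  \int[P]_w f (Y n w) @[n --> \oo] --> \int[gauss]_x f x.
Proof.
move=> mY u1 Yu f M cf fM.
have mf : measurable_fun setT f by exact: continuous_measurable_fun.
have M0 : 0 <= M by rewrite (le_trans _ (fM 0)).
apply/cvgrPdist_le => eps eps0.
pose e := eps / (3 + 4 * M).
have c0 : 0 < 3 + 4 * M by rewrite ltr_wpDr ?mulr_ge0.
have e0 : 0 < e by rewrite divr_gt0.
have epsE : eps = e + 2 * M * e + (e + 2 * M * e + e) by rewrite /e; field; rewrite gt_eqF.
have [K [K0 tightK]] := tight mW W_law e0.
have [dl dl0 fdl] := continuous_near_segment K cf e0.
near=> n.
rewrite distrC epsE.
rewrite (le_trans (ler_distD (\int[P]_w f (linform (u n) (W n w))) _ _)) // lerD //; last first.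
  have : \sum_k u n 0 k ^+ 2 = 1 by near: n.
  by move: (u n); near: n; exact: uniform_linform.
have Yn : forall w, l1norm (W n w) <= K -> `|Y n w - linform (u n) (W n w)| <= dl.
  by near: n; exact: Yu.
have un : \sum_k u n 0 k ^+ 2 = 1 by near: n.
have tightn : (P [set w | (K < l1norm (W n w))%R] <= e%:E)%E by near: n.
apply: (expectation_close _ _ _ _ (measurable_l1_gt n K)) => //.
- exact: measurableT_comp.
- by apply: measurableT_comp => //; exact: measurable_linform.
move=> w /negP; rewrite -leNgt => wK; rewrite distrC; apply: fdl.
  have /le_trans : `|linform (u n) (W n w)| <= 1 * l1norm (W n w).
    by apply: linform_le => k; exact: unit_coord_le1.
  by apply; rewrite mul1r.
by rewrite distrC Yn.
Unshelve. all: by end_near. Qed.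

End SlutskyTheorem.

(** * Rate of convergence of the sample covariance *)

Section Integrability.
Context {R : realType} d (T : measurableType d) (P : probability T R).

Lemma le_integrable_real (f g : T -> R) : measurable_fun setT f ->
  (forall w, `|f w| <= g w) -> P.-integrable setT (EFin \o g) ->
  P.-integrable setT (EFin \o f).
Proof.
move=> mf fg; apply: le_integrable => //; first exact/measurable_EFinP.
by move=> w _ /=; rewrite lee_fin (le_trans (fg w)) // ler_norm.
Qed.

Lemma integrableD_real (f g : T -> R) : P.-integrable setT (EFin \o f) ->
  P.-integrable setT (EFin \o g) -> P.-integrable setT (EFin \o (fun w => f w + g w)).
Proof.
move=> intf intg; rewrite (_ : _ \o _ = ((EFin \o f) \+ (EFin \o g))%E) //.
exact: integrableD.
Qed.

Lemma integrable_sum_real I (s : seq I) (F : I -> T -> R) :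
  (forall k, P.-integrable setT (EFin \o F k)) ->
  P.-integrable setT (EFin \o (fun w => \sum_(k <- s) F k w)).
Proof.
move=> intF; elim: s => [|k s IHs].
  rewrite (_ : _ \o _ = cst 0%:E); first exact: finite_measure_integrable_cst.
  by apply/funext => w /=; rewrite big_nil.
rewrite (_ : _ \o _ = EFin \o (fun w => F k w + \sum_(k <- s) F k w)).
  exact: integrableD_real.
by apply/funext => w /=; rewrite big_cons.
Qed.

Lemma Rintegral_sum I (s : seq I) (F : I -> T -> R) :
  (forall k, P.-integrable setT (EFin \o F k)) ->
  \int[P]_w (\sum_(k <- s) F k w) = \sum_(k <- s) \int[P]_w F k w.
Proof.
move=> intF; elim: s => [|k s IHs].
  by rewrite big_nil; under eq_Rintegral do rewrite big_nil; rewrite Rintegral_prob_cst.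
rewrite big_cons -IHs -RintegralD //; last exact: integrable_sum_real.
by apply: eq_Rintegral => w _; rewrite big_cons.
Qed.

Lemma markov_real (X : T -> R) (K : R) : measurable_fun setT X ->
  (forall w, 0 <= X w) -> P.-integrable setT (EFin \o X) -> 0 < K ->
  (P [set w | (K < X w)%R] <= ((\int[P]_w X w) / K)%:E)%E.
Proof.
move=> mX X0 iX K0; set A := [set w | _].
have mA : measurable A.
  by rewrite -[X in measurable X]setTI; exact: measurable_fun_ltr.
rewrite EFinM muleC; rewrite -lee_pdivrMl ?invr_gt0 // invrK.
rewrite /Rintegral fineK; last exact: integrable_fin_num.
rewrite -(setIT A) -integral_indic // -ge0_integralZl //; last 2 first.
- by apply/measurable_EFinP; exact: measurable_indic.
- by rewrite lee_fin ltW.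
apply: ge0_le_integral => //.
- by move=> w _; rewrite mule_ge0 // ?lee_fin ?(ltW K0).
- apply: emeasurable_funM => //; apply/measurable_EFinP; exact: measurable_indic.
- exact/measurable_EFinP.
- move=> w _; rewrite indicE; case: (boolP (w \in A)) => [|_].
    by rewrite inE mule1 lee_fin /A /= => /ltW.
  by rewrite mule0 lee_fin.
Qed.

End Integrability.

Section Sample.
Context {R : realType} d (T : measurableType d) (P : probability T R) (p n : nat).
Context (mu : probability (p.-tuple R) R) (Z : T -> 'M[R]_(n, p)).
Hypothesis Z_iid : iid_rows P mu Z.

Let row r w := row_tuple (Z w) r.

Lemma measurable_row r : measurable_fun setT (row r).
Proof.
apply/measurable_fun_tnthP => j; have [mZ _ _] := Z_iid.
rewrite (_ : _ \o _ = fun w => Z w r j); first exact: mZ.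
by apply/funext => w /=; rewrite tnth_mktuple.
Qed.

Lemma law_row r A : measurable A -> P (row r @^-1` A) = mu A.
Proof. by move=> mA; have [_ law _] := Z_iid; exact: law. Qed.

Lemma law_row_pair r s A B : r != s -> measurable A -> measurable B ->
  P (row r @^-1` A `&` row s @^-1` B) = (mu A * mu B)%E.
Proof.
move=> rs mA mB; have [_ law indep] := Z_iid.
(* independence is stated for all rows at once: leave the others unconstrained *)
pose C k := if k == r then A else if k == s then B else setT.
have mC k : measurable (C k) by rewrite /C; case: ifP => // _; case: ifP.
have -> : row r @^-1` A `&` row s @^-1` B = [set w | forall k, C k (row_tuple (Z w) k)].
  apply/seteqP; split => w /=.
    by move=> [Aw Bw] k; rewrite /C; case: eqP => [->//|_]; case: eqP => [->//|_].
  move=> Cw; split; first by have := Cw r; rewrite /C eqxx.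
  by have := Cw s; rewrite /C eq_sym (negbTE rs) eqxx.
rewrite indep // (bigD1 r) //= (bigD1 s) /=; last by rewrite eq_sym.
rewrite big1 => [|k /andP[kr ks]]; last first.
  by rewrite /C (negbTE kr) (negbTE ks) [X in P X](_ : _ = setT) ?probability_setT.
by rewrite mule1 !law // /C eqxx eq_sym (negbTE rs) eqxx.
Qed.

Lemma integral_row r (g : p.-tuple R -> R) : measurable_fun setT g ->
  mu.-integrable setT (EFin \o g) ->
  P.-integrable setT (EFin \o (fun w => g (row r w))) /\
  \int[P]_w g (row r w) = \int[mu]_t g t.
Proof.
move=> mg ig; have mr := measurable_row r.
have mgr : measurable_fun setT (fun w => g (row r w)) by exact: measurableT_comp.
have igr : P.-integrable setT (EFin \o (fun w => g (row r w))).
  apply/integrableP; split; first exact/measurable_EFinP.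
  have /integrableP[_] := ig.
  rewrite (@eq_measure_integral _ _ _ _ (pushforward P (row r)) _ _); last first.
    by move=> A mA _; rewrite /= /pushforward law_row.
  rewrite ge0_integral_pushforward //.
  by apply/measurableT_comp => //; exact/measurable_EFinP.
split=> //; rewrite /Rintegral; congr fine.
rewrite [RHS](@eq_measure_integral _ _ _ _ (pushforward P (row r)) _ _); last first.
  by move=> A mA _; rewrite /= /pushforward law_row.
by rewrite integral_pushforward //; exact/measurable_EFinP.
Qed.

(** The joint law of two distinct rows is [mu \x mu], so the expectation of the product
    is computed by Fubini's theorem. *)
Lemma uncorrelated_rows r s (g : p.-tuple R -> R) : r != s -> measurable_fun setT g ->
  mu.-integrable setT (EFin \o g) -> mu.-integrable setT (EFin \o (fun t => g t ^+ 2)) ->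
  \int[mu]_t g t = 0 ->
  P.-integrable setT (EFin \o (fun w => g (row r w) * g (row s w))) /\
  \int[P]_w (g (row r w) * g (row s w)) = 0.
Proof.
move=> rs mg ig ig2 g0.
have mg2 : measurable_fun setT (fun t => g t ^+ 2) by exact: measurable_funX.
have mr k : measurable_fun setT (row k) by exact: measurable_row.
have mgr k : measurable_fun setT (fun w => g (row k w)) by exact: measurableT_comp.
have mgg : measurable_fun setT (fun w => g (row r w) * g (row s w)) by exact: measurable_funM.
have igg : P.-integrable setT (EFin \o (fun w => g (row r w) * g (row s w))).
  apply: (@le_integrable_real _ _ _ _ _ (fun w => g (row r w) ^+ 2 + g (row s w) ^+ 2)) => //.
    move=> w; rewrite normrM -[X in _ <= X + _]real_normK ?num_real //.
    rewrite -[X in _ <= _ + X]real_normK ?num_real //.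
    have := sqr_ge0 (`|g (row r w)| - `|g (row s w)|).
    have := mulr_ge0 (normr_ge0 (g (row r w))) (normr_ge0 (g (row s w))).
    by set a := `|_|; set b := `|_| => *; nra.
  by apply: integrableD_real; exact: (integral_row _ mg2 ig2).1.
split => //; rewrite /Rintegral.
pose phi w := (row r w, row s w).
have mphi : measurable_fun setT phi by exact: measurable_fun_pair.
pose F (xy : p.-tuple R * p.-tuple R) := (g xy.1 * g xy.2)%:E.
have mF : measurable_fun setT F.
  by apply/measurable_EFinP/measurable_funM; apply: measurableT_comp.
have muE A : measurable A -> (mu \x mu)%E A = pushforward P phi A.
  move=> mA; apply: product_measure_unique => // B C mB mC.
  by rewrite /pushforward -(law_row_pair rs mB mC).
have E (f : p.-tuple R * p.-tuple R -> \bar R) :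
    (\int[(mu \x mu)%E]_z f z = \int[pushforward P phi]_z f z)%E.
  by apply: eq_measure_integral => A mA _; exact: muE.
have iF : (mu \x mu)%E.-integrable setT F.
  apply/integrableP; split => //; rewrite E ge0_integral_pushforward //; last first.
    exact: measurableT_comp.
  by have /integrableP[] := igg.
rewrite [X in fine X](_ : _ = \int[(mu \x mu)%E]_z F z)%E; last first.
  by rewrite E integral_pushforward.
rewrite -integral12_prod_meas1 //.
rewrite [X in fine X](_ : _ = 0%E) //.
apply: integral0_eq => x _.
rewrite /fubini_F /F /=; under eq_integral do rewrite EFinM.
rewrite integralZl //.
have -> : (\int[mu]_y (g y)%:E)%E = 0%E.
  by rewrite -[LHS]fineK ?[fine _]g0 //; exact: integrable_fin_num ig.
by rewrite mule0.
Qed.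

End Sample.

Section LLN.
Context {R : realType} (p : nat) (mu : probability (p.-tuple R) R).
Hypothesis mu_centered : forall j : 'I_p, ('E_mu[coordinate j] = 0)%E.
Hypothesis mu_cumulant : finite_fourth_cumulant mu.

Lemma measurable_coordinate (j : 'I_p) : measurable_fun setT (@coordinate R p j).
Proof. exact: measurable_tnth. Qed.

(** A finite cumulant is a difference of extended reals that is finite, so each of its
    terms is finite; the first one is the fourth moment because the mean is 0. *)
Lemma fourth_moment (j : 'I_p) :
  mu.-integrable setT (EFin \o (fun t => coordinate j t ^+ 4)).
Proof.
have m4 : measurable_fun setT (fun t => @coordinate R p j t ^+ 4).
  by apply: measurable_funX; exact: measurable_coordinate.
have := mu_cumulant j j j j.
rewrite /cumulant4 mu_centered /= !fin_numB => /andP[/andP[/andP[+ _] _] _].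
rewrite (_ : (_ * _)%R = (fun t => @coordinate R p j t ^+ 4)); last first.
  by apply/funext => t; rewrite !fctE /= subr0; ring.
rewrite unlock => fin4; apply/integrableP; split; first exact/measurable_EFinP.
rewrite -ge0_fin_numE; last by apply: integral_ge0 => t _; exact: abse_ge0.
rewrite (eq_integral (fun t => (coordinate j t ^+ 4)%:E)) // => t _ /=.
by rewrite ger0_norm // exprn_even_ge0.
Qed.

Let Sigma := cov_mx mu.

Definition centered_product (j k : 'I_p) (t : p.-tuple R) : R :=
  coordinate j t * coordinate k t - Sigma j k.

Lemma measurable_product (j k : 'I_p) :
  measurable_fun setT (fun t => @coordinate R p j t * coordinate k t).
Proof. by apply: measurable_funM; exact: measurable_coordinate. Qed.

Lemma measurable_centered_product (j k : 'I_p) :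
  measurable_fun setT (centered_product j k).
Proof. by apply: measurable_funB => //; exact: measurable_product. Qed.

Lemma centered_product_sqr_integrable j k :
  mu.-integrable setT (EFin \o (fun t => centered_product j k t ^+ 2)).
Proof.
apply: (@le_integrable_real _ _ _ _ _ (fun t => coordinate j t ^+ 4 + coordinate k t ^+ 4
   + 2 * Sigma j k ^+ 2)).
- by apply: measurable_funX; exact: measurable_centered_product.
- move=> t; rewrite ger0_norm ?sqr_ge0 // /centered_product.
  set a := coordinate j t; set b := coordinate k t; set s := Sigma j k.
  have := sqr_ge0 (a ^+ 2 - b ^+ 2); have := sqr_ge0 (a * b + s).
  by move=> *; nra.
- apply: integrableD_real; last exact: finite_measure_integrable_cst.
  by apply: integrableD_real; exact: fourth_moment.
Qed.

Lemma centered_product_integrable j k :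
  mu.-integrable setT (EFin \o centered_product j k).
Proof.
apply: (@le_integrable_real _ _ _ _ _ (fun t => 1 + centered_product j k t ^+ 2)).
- exact: measurable_centered_product.
- move=> t; set a := centered_product j k t; rewrite -real_normK ?num_real //.
  have := sqr_ge0 (`|a| - 1); have := normr_ge0 a; set b := `|a|.
  by move=> *; nra.
- apply: integrableD_real; first exact: finite_measure_integrable_cst.
  exact: centered_product_sqr_integrable.
Qed.

Lemma product_integrable j k :
  mu.-integrable setT (EFin \o (fun t => coordinate j t * coordinate k t)).
Proof.
have -> : (fun t => coordinate j t * coordinate k t) =
    (fun t => centered_product j k t + Sigma j k).
  by apply/funext => t; rewrite /centered_product subrK.
apply: integrableD_real; first exact: centered_product_integrable.
exact: finite_measure_integrable_cst.
Qed.

Lemma centered_product_mean j k : \int[mu]_t centered_product j k t = 0.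
Proof.
rewrite RintegralB //; last exact: finite_measure_integrable_cst.
  rewrite Rintegral_prob_cst /Sigma mxE unlock !mu_centered /= unlock.
  apply/eqP; rewrite subr_eq0 /Rintegral; apply/eqP; congr fine.
  by apply: eq_integral => t _; rewrite !fctE /= !subr0.
exact: product_integrable.
Qed.

Context d (T : measurableType d) (P : probability T R).

(** Squared Frobenius distance to the population covariance. *)
Definition cov_error n (X : 'M[R]_(n, p)) : R :=
  \sum_(jk : 'I_p * 'I_p) ((X^T *m X) jk.1 jk.2 - Sigma jk.1 jk.2) ^+ 2.

Lemma measurable_cov_error n (X : T -> 'M[R]_(n, p)) : random_matrix X ->
  measurable_fun setT (fun w => cov_error (X w)).
Proof.
move=> mX; apply: measurable_sum => jk; apply: measurable_funX; apply: measurable_funB => //.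
by apply: random_matrix_mul => //; exact: random_matrix_tr.
Qed.

Lemma cov_error_entry n (X : 'M[R]_(n, p)) (K : R) : 0 <= K -> cov_error X <= K ^+ 2 ->
  forall j k, `|(X^T *m X) j k - Sigma j k| <= K.
Proof.
move=> K0 XK j k; rewrite -[leRHS](ger0_norm K0) -ler_sqr ?nnegrE ?normr_ge0 //.
rewrite !real_normK ?num_real //; apply: le_trans XK.
by rewrite /cov_error (bigD1 (j, k)) //= lerDl sumr_ge0 // => ? _; exact: sqr_ge0.
Qed.

(** The entries of the error are means of [n] uncorrelated centered variables with
    finite variance; their second moments are [O(1/n)] and Markov's inequality
    applies to their sum. *)
Lemma sample_covariance_rate : exists2 V : R, 0 <= V &
  forall n (Z : T -> 'M[R]_(n, p)), (0 < n)%N -> iid_rows P mu Z -> forall K : R, 0 < K ->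
  (P [set w | (K ^+ 2 / n%:R < cov_error ((Num.sqrt n%:R)^-1 *: Z w))%R] <=
    (V / K ^+ 2)%:E)%E.
Proof.
pose v (jk : 'I_p * 'I_p) := \int[mu]_t (centered_product jk.1 jk.2 t ^+ 2).
have v0 jk : 0 <= v jk by apply: Rintegral_ge0 => t _; exact: sqr_ge0.
exists (\sum_jk v jk); first exact: sumr_ge0.
move=> n Z n0 Z_iid K K0.
have nR : 0 < n%:R :> R by rewrite ltr0n.
pose D jk r w := centered_product jk.1 jk.2 (row_tuple (Z w) r).
have entryE jk w : (((Num.sqrt n%:R)^-1 *: Z w)^T *m ((Num.sqrt n%:R)^-1 *: Z w)) jk.1 jk.2
    - Sigma jk.1 jk.2 = n%:R^-1 * \sum_r D jk r w.
  rewrite [(_ *: Z w)^T]linearZ /= -scalemxAl -scalemxAr scalerA -invfM -expr2 sqr_sqrtr ?ler0n //.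
  rewrite mxE mxE [in RHS]big_split /= sumrN sumr_const card_ord mulrDr; congr (_ + _).
    by congr (_ * _); apply: eq_bigr => r _; rewrite mxE /coordinate !tnth_mktuple.
  have nS (x : R) : x *+ n = n%:R * x by rewrite mulr_natl.
  by rewrite (nS (Sigma _ _)) mulrN mulKf // gt_eqF.
have iDD jk r s : P.-integrable setT (EFin \o (fun w => D jk r w * D jk s w)).
  have [<-|rs] := eqVneq r s.
    have [+ _] := integral_row Z_iid r (measurable_funX 2 (measurable_centered_product jk.1 jk.2))
       (centered_product_sqr_integrable jk.1 jk.2).
    by rewrite (_ : (fun w => _) = (fun w => D jk r w * D jk r w)) //;
      apply/funext => w; rewrite expr2.
  exact: (uncorrelated_rows Z_iid rs (measurable_centered_product jk.1 jk.2)
    (centered_product_integrable _ _) (centered_product_sqr_integrable _ _)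
    (centered_product_mean _ _)).1.
have EDD jk r s : \int[P]_w (D jk r w * D jk s w) = (r == s)%:R * v jk.
  have [<-|rs] := eqVneq r s.
    rewrite mul1r /v.
    have [_ <-] := integral_row Z_iid r (measurable_funX 2 (measurable_centered_product jk.1 jk.2))
       (centered_product_sqr_integrable jk.1 jk.2).
    by apply: eq_Rintegral => w _; rewrite expr2.
  rewrite mul0r; exact: (uncorrelated_rows Z_iid rs (measurable_centered_product jk.1 jk.2)
    (centered_product_integrable _ _) (centered_product_sqr_integrable _ _)
    (centered_product_mean _ _)).2.
pose Q w := \sum_jk \sum_r \sum_s D jk r w * D jk s w.
have iQ : P.-integrable setT (EFin \o Q).
  by do 3 (apply: integrable_sum_real => ?); exact: iDD.
have EQ : \int[P]_w Q w = n%:R * \sum_jk v jk.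
  rewrite /Q Rintegral_sum => [|jk]; last by do 2 (apply: integrable_sum_real => ?).
  rewrite mulr_sumr; apply: eq_bigr => jk _.
  rewrite Rintegral_sum => [|r]; last by apply: integrable_sum_real => ?.
  under eq_bigr => r _.
    rewrite Rintegral_sum //; under eq_bigr do rewrite EDD.
    rewrite (bigD1 r) //= eqxx mul1r big1 ?addr0 => [|s]; last first.
      by rewrite eq_sym => /negbTE ->; rewrite mul0r.
    over.
  by rewrite sumr_const card_ord mulr_natl.
have errE w : cov_error ((Num.sqrt n%:R)^-1 *: Z w) = n%:R^-1 ^+ 2 * Q w.
  rewrite /cov_error mulr_sumr; apply: eq_bigr => jk _; rewrite entryE exprMn; congr (_ * _).
  rewrite expr2 mulr_suml; apply: eq_bigr => r _; rewrite mulr_sumr.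
  exact: eq_bigr.
have -> : [set w | K ^+ 2 / n%:R < cov_error ((Num.sqrt n%:R)^-1 *: Z w)] =
    [set w | n%:R * K ^+ 2 < Q w].
  apply/funext => w /=; congr is_true; rewrite errE -(ltr_pM2l (exprn_gt0 2 nR)).
  by rewrite exprVn mulVKf ?expf_neq0 ?gt_eqF //; congr (_ < _); field; rewrite gt_eqF.
have mQ : measurable_fun setT Q.
  by apply/measurable_EFinP; exact: measurable_int iQ.
have Q0 w : 0 <= Q w.
  apply: sumr_ge0 => jk _.
  under eq_bigr do rewrite -mulr_sumr; rewrite -mulr_suml -expr2; exact: sqr_ge0.
have nK : 0 < n%:R * K ^+ 2 by rewrite mulr_gt0 // exprn_gt0.
apply: le_trans (markov_real mQ Q0 iQ nK) _; rewrite EQ lee_fin.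
by rewrite -mulf_div divff ?mul1r // gt_eqF.
Qed.

End LLN.

(** * The limit law given the data *)

Section Limits.
Context {R : realType}.

Lemma limn_esup_lt (u : (\bar R)^nat) (a : \bar R) : (limn_esup u < a)%E ->
  exists2 b : \bar R, (b < a)%E & \forall n \near \oo, (u n <= b)%E.
Proof.
rewrite /limn_esup /limf_esup => /ereal_inf_lt[_ [V Voo <-] supa].
exists (ereal_sup (u @` V)) => //; apply: filterS Voo => n Vn.
by apply: ereal_sup_ubound; exists n.
Qed.

Lemma limn_esup_bounded (u : R^nat) : (limn_esup (EFin \o u) < +oo)%E ->
  exists k : R, \forall n \near \oo, u n <= k.
Proof.
move=> /limn_esup_lt[[k| |] // _ uk].
  by exists k; apply: filterS uk => n /=; rewrite lee_fin.
by exists 0; apply: filterS uk => n /=; rewrite leeNy_eq.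
Qed.

Lemma limn_einf_gt1 (u : (\bar R)^nat) : (1 < limn_einf u)%E ->
  exists2 r : R, 1 < r & \forall n \near \oo, (r%:E <= u n)%E.
Proof.
rewrite /limn_einf lteNr => /limn_esup_lt[b b1 ub].
have [r r1 br] : exists2 r : R, 1 < r & (b <= (- r)%:E)%E.
  case: b b1 {ub} => [b| |] //.
    by rewrite lte_fin => b1; exists (- b); rewrite ?opprK // ltrNr.
  by exists 2; rewrite ?ltr1n // leNye.
exists r => //; apply: filterS ub => n unb.
by have := le_trans unb br; rewrite EFinN leeN2.
Qed.

End Limits.

Section SingularValueGap.
Context {R : realType} (p : nat).

(** Consecutive ratios at least [r] separate [l_i] from every other singular value by
    a factor [r], in one direction or the other; [1 - r^-2] is the smaller of the
    two resulting relative gaps. *)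
Lemma singular_value_gap (l : 'rV[R]_p.+1) (i : 'I_p.+1) (k r : R) : 1 < r ->
  (forall j, 0 < l 0 j) ->
  (forall j j' : 'I_p.+1, (j <= j')%N -> l 0 j' <= l 0 j) ->
  l 0 ord0 / l 0 ord_max <= k ->
  (r%:E <= \big[mine/+oo]_(j < p) (l 0 (widen_ord (leqnSn p) j) / l 0 (lift ord0 j))%:E)%E ->
  (forall j, l 0 j <= k * l 0 i) /\
  (forall j, j != i -> (1 - r^-2) * l 0 i ^+ 2 <= `|l 0 i ^+ 2 - l 0 j ^+ 2|).
Proof.
move=> r1 l0 lnoninc lk lr.
have r0 : 0 < r by rewrite (lt_trans ltr01).
have k0 : 0 <= k by rewrite (le_trans _ lk) // divr_ge0 // ltW.
have step (j j' : 'I_p.+1) : (j < j')%N -> r * l 0 j' <= l 0 j.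
  move=> jj'.
  have jp : (j < p)%N by rewrite (leq_trans jj') // -ltnS ltn_ord.
  have := le_trans lr (@bigmin_le _ _ _ _ (Ordinal jp) _); rewrite lee_fin.
  rewrite ler_pdivlMr // => /le_trans lj.
  have -> : l 0 j = l 0 (widen_ord (leqnSn p) (Ordinal jp)) by congr (l 0 _); apply: val_inj.
  apply: le_trans (lj _ (lexx _)); rewrite ler_pM2l //.
  by apply: lnoninc; rewrite /= /bump.
split=> [j|j ji].
  rewrite (le_trans (lnoninc ord0 j _)) //.
  have l0k : l 0 ord0 <= k * l 0 ord_max by rewrite -ler_pdivrMr.
  by rewrite (le_trans l0k) // ler_wpM2l // lnoninc // -ltnS.
have rV : r^-2 < 1 by rewrite invf_lt1 ?exprn_gt0 // exprn_egt1.
have [ij|] := ltnP i j.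
  have sq : l 0 j ^+ 2 <= r^-2 * l 0 i ^+ 2.
    rewrite -ler_pdivrMl ?invr_gt0 ?exprn_gt0 // invrK -exprMn.
    by rewrite lerXn2r ?nnegrE ?mulr_ge0 ?(ltW (l0 _)) ?(ltW r0) // step.
  rewrite ger0_norm; first by rewrite mulrBl mul1r lerD2l lerN2.
  by rewrite subr_ge0 (le_trans sq) // ger_pMl ?exprn_gt0 // ltW.
rewrite leq_eqVlt => /orP[/eqP ji'|ji']; first by move/eqP: ji => []; apply: val_inj.
have sq : l 0 i ^+ 2 * r ^+ 2 <= l 0 j ^+ 2.
  by rewrite -exprMn mulrC lerXn2r ?nnegrE ?mulr_ge0 ?(ltW (l0 _)) ?(ltW r0) // step.
have r2 : 1 <= r ^+ 2 by rewrite exprn_ege1 // ltW.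
have li : 0 < l 0 i ^+ 2 by rewrite exprn_gt0.
have rr : 0 < r ^+ 2 - 1 by rewrite subr_gt0 exprn_egt1.
rewrite ler0_norm; last first.
  by rewrite subr_le0 (le_trans _ sq) // ler_peMr // ltW.
rewrite opprB; apply: (@le_trans _ _ ((r ^+ 2 - 1) * l 0 i ^+ 2)); last first.
  by move: sq; rewrite mulrBl mul1r mulrC => sq; rewrite lerD2r.
rewrite ler_wpM2r ?(ltW li) //.
have -> : 1 - r^-2 = (r ^+ 2 - 1) / r ^+ 2 by field; rewrite gt_eqF.
by rewrite ler_pdivrMr ?exprn_gt0 // ler_peMr // ltW.
Qed.

End SingularValueGap.

Section HalfVectorization.
Context {R : realType} (p : nat).

Lemma vechE (E : 'M[R]_p) (b : 'I_(hdim p)) :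
  ((@dup_mx R p)^T *m vec E) b 0 = E (enum_val b).1 (enum_val b).2.
Proof.
rewrite mxE (bigD1 (vec_index (enum_val b).1 (enum_val b).2)) //= big1 => [|a /negbTE ab].
  by rewrite !mxE eqxx mul1r addr0 -[RHS]vecE mxE.
by rewrite !mxE ab mul0r.
Qed.

Lemma compress_diag (G : 'M[R]_(p * p)) (b : 'I_(hdim p)) (a := vec_index (enum_val b).1 (enum_val b).2) :
  compress G b b = G a a.
Proof.
rewrite /compress mxE (bigD1 a) //= big1 => [|c /negbTE ca]; last first.
  by rewrite [dup_mx _ _ _]mxE ca mulr0.
rewrite [dup_mx _ _ _]mxE eqxx mulr1 addr0 mxE (bigD1 a) //= big1 => [|c /negbTE ca].
  by rewrite !mxE eqxx mul1r addr0.
by rewrite !mxE ca mul0r.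
Qed.

Lemma upper_index (j k : 'I_p) : (j <= k)%N ->
  exists b : 'I_(hdim p), enum_val b = (j, k).
Proof.
move=> jk; have jkU : (j, k) \in upper_pairs p by rewrite inE.
by exists (enum_rank_in jkU (j, k)); rewrite enum_rankK_in.
Qed.

Lemma loewner_diag n (A B : 'M[R]_n) b : loewner_le A B -> A b b <= B b b.
Proof.
move=> [_ /(_ (delta_mx b 0))].
by rewrite trmx_delta -rowE -colE !mxE subr_ge0.
Qed.

Lemma sym_max_le (E : 'M[R]_p) (c : R) : E^T = E ->
  (forall b : 'I_(hdim p), `|E (enum_val b).1 (enum_val b).2| <= c) ->
  forall j k, `|E j k| <= c.
Proof.
move=> symE Ec j k; have [jk|kj] := leqP j k.
  by have [b bE] := upper_index jk; have := Ec b; rewrite bE.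
have [b bE] := upper_index (ltnW kj); have := Ec b.
by rewrite bE /= -{1}symE mxE.
Qed.

End HalfVectorization.

Section RelativeError.
Context {R : realType}.

(** With [a = La / L = 1 + E + rho] and [q = lam / L], the left-hand side is
    [s ((1 - q) + rho - E^2 - E rho) / a], and [a >= 1/2]. *)
Lemma relative_error (s La L lam E c e r : R) : 0 < L -> 0 <= s ->
  `|La / L - 1 - E| <= c * e ^+ 2 -> `|E| <= e -> `|L - lam| <= r ->
  0 <= c -> 0 <= e -> e <= 1 -> e + c * e ^+ 2 <= 1 / 2 ->
  `|s * La^-1 * (La - lam) - s * E| <= 2 * (s * r / L + (2 * c + 1) * (s * e ^+ 2)).
Proof.
move=> L0 s0 Hrho HE Hr c0 e0 e1 small.
set rho := La / L - 1 - E; set a := La / L.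
have aE : a = 1 + E + rho by rewrite /rho -/a; ring.
have a2 : 1 / 2 <= a.
  rewrite aE; move: HE Hrho => /ler_normlP[H1 H2] /ler_normlP[H3 H4].
  by rewrite -/rho in H3 H4; lra.
have a0 : 0 < a by lra.
have La0 : La != 0 by apply/eqP => La0; move: a0; rewrite /a La0 mul0r ltxx.
have -> : s * La^-1 * (La - lam) - s * E =
   s * ((L - lam) / L + (rho - E ^+ 2 - E * rho)) / a.
  have -> : rho = La / L - 1 - E by [].
  rewrite /a; field; rewrite ?La0 ?gt_eqF //.
rewrite !normrM (ger0_norm s0) (gtr0_norm (x := a^-1)) ?invr_gt0 //.
have num : `|(L - lam) / L + (rho - E ^+ 2 - E * rho)| <= r / L + (2 * c + 1) * e ^+ 2.
  rewrite (le_trans (ler_normD _ _)) // lerD //.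
    by rewrite normrM normfV (gtr0_norm L0) ler_pM2r ?invr_gt0.
  have h1 : `|E ^+ 2| <= e ^+ 2 by rewrite normrX lerXn2r ?nnegrE.
  have h2 : `|E * rho| <= 1 * (c * e ^+ 2).
    by rewrite normrM ler_pM // (le_trans HE).
  have := ler_normB (rho - E ^+ 2) (E * rho); have := ler_normB rho (E ^+ 2).
  by move: Hrho; rewrite -/rho; move: h1 h2; set x1 := `|_|; set x2 := `|_|;
    set x3 := `|_|; set x4 := `|_|; set x5 := `|_|; move=> *; lra.
have num0 : 0 <= r / L + (2 * c + 1) * e ^+ 2 by rewrite (le_trans _ num).
have aV : a^-1 <= 2 by rewrite -[leRHS]invrK lef_pV2 ?posrE ?invr_gt0 //; lra.
have -> : 2 * (s * r / L + (2 * c + 1) * (s * e ^+ 2)) =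
  s * (r / L + (2 * c + 1) * e ^+ 2) * 2 by ring.
by rewrite ler_pM ?mulr_ge0 ?invr_ge0 ?(ltW a0) // ler_wpM2l.
Qed.

End RelativeError.

Section OneSketch.
Context {R : realType} (p : nat).

Lemma posdefZ n (A : 'M[R]_n) (c : R) : 0 < c -> posdefmx A -> posdefmx (c *: A).
Proof.
move=> c0 [symA posA]; split; first by rewrite linearZ /= symA.
by move=> x x0; rewrite -scalemxAr -scalemxAl mxE mulr_gt0 // posA.
Qed.

(** Conjugation by the right singular vectors leaves the eigenvalues unchanged. *)
Lemma sketched_eigvalE m n (S : 'M[R]_(m, n)) (X U : 'M[R]_(n, p)) l V i :
  is_svd X U l V ->
  sketched_eigval S X i =
    lambda (diag_mx l *m (1%:M + (U^T *m S^T *m S *m U - 1%:M)) *m diag_mx l) i.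
Proof.
move=> [XE _ VV _ _]; rewrite /sketched_eigval addrCA subrr addr0.
rewrite -[lambda (diag_mx l *m _ *m _)](lambda_conj _ (mulmx1C VV)).
by rewrite XE !trmx_mul trmxK tr_diag_mx !mulmxA.
Qed.

Lemma gram_eigval n (X U : 'M[R]_(n, p)) l V i :
  is_svd X U l V -> lambda (X^T *m X) i = l 0 i ^+ 2.
Proof.
move=> [XE UU VV lnoninc l0].
have -> : X^T *m X = V *m diag_mx (\row_j l 0 j ^+ 2) *m V^T.
  rewrite XE !trmx_mul trmxK tr_diag_mx !mulmxA -[_ *m U^T *m U]mulmxA UU mulmx1.
  rewrite -[V *m diag_mx l *m diag_mx l]mulmxA mulmx_diag.
  by congr (_ *m diag_mx _ *m _); apply/rowP => k; rewrite !mxE expr2.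
rewrite lambda_conj ?(mulmx1C VV) //.
rewrite lambda_diag ?mxE // => j k jk; rewrite !mxE.
by rewrite lerXn2r ?nnegrE ?(ltW (l0 _)) ?lnoninc.
Qed.

(** The linear form [u] undoes the standardization for the diagonal entry [(i, i)],
    whose asymptotic variance is [tau * G_(ii),(ii)]. *)
Lemma standardized_linform (m : nat) (tau : R) (G : 'M[R]_(p * p)) (E : 'M[R]_p) i b
    (A := tau *: compress G) (u : 'rV[R]_(hdim p)) :
  0 < tau -> enum_val b = (i, i) -> posdefmx A ->
  (forall z : 'cV[R]_(hdim p),
    \sum_k u 0 k * (invsqrtmx A *m z) k 0 = z b 0 / Num.sqrt (A b b)) ->
  linform u (Num.sqrt m%:R *: (invsqrtmx A *m ((@dup_mx R p)^T *m vec E))) =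
    Num.sqrt (m%:R / (tau * G (vec_index i i) (vec_index i i))) * E i i.
Proof.
move=> tau0 bE posA uP; set z := (dup_mx p)^T *m vec E.
transitivity (Num.sqrt m%:R * \sum_k u 0 k * (invsqrtmx A *m z) k 0).
  by rewrite /linform mulr_sumr; apply: eq_bigr => k _; rewrite mxE mulrCA.
have Abb : A b b = tau * G (vec_index i i) (vec_index i i).
  by rewrite mxE compress_diag bE.
have Abb0 : 0 < A b b by exact: posdef_diag_gt0.
rewrite uP vechE bE -Abb sqrtrM ?ler0n // sqrtrV ?(ltW Abb0) //.
by rewrite mulrA mulrAC.
Qed.

(** All the entries of [E] are recovered from the standardized vector at the scale
    [sqrt (tau / m)]. *)
Lemma standardized_bound (m : nat) (tau C0 : R) (G : 'M[R]_(p * p)) (E : 'M[R]_p)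
    (A := tau *: compress G) :
  (0 < m)%N -> 0 < tau -> posdefmx A -> 0 <= C0 -> loewner_le (compress G) C0%:M -> E^T = E ->
  forall j k, `|E j k| <= Num.sqrt C0 * Num.sqrt (tau / m%:R) *
    l1norm (Num.sqrt m%:R *: (invsqrtmx A *m ((@dup_mx R p)^T *m vec E))).
Proof.
move=> m0 tau0 posA C00 GC symE; apply: sym_max_le => // b; set z := (dup_mx p)^T *m vec E.
have mR : 0 < m%:R :> R by rewrite ltr0n.
have -> : l1norm (Num.sqrt m%:R *: (invsqrtmx A *m z)) =
    Num.sqrt m%:R * \sum_k `|(invsqrtmx A *m z) k 0|.
  rewrite /l1norm mulr_sumr; apply: eq_bigr => k _.
  by rewrite mxE normrM ger0_norm ?sqrtr_ge0.
rewrite -vechE (le_trans (invsqrt_bound z b posA)) // mulrA ler_wpM2r ?sumr_ge0 //.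
rewrite -!sqrtrM ?mulr_ge0 ?divr_ge0 ?ler0n ?(ltW tau0) //.
rewrite ler_wsqrtr // mulrA mulfVK ?gt_eqF // mxE mulrC ler_wpM2r ?(ltW tau0) //.
by have := loewner_diag b GC; rewrite [X in _ <= X]mxE eqxx mulr1n.
Qed.

End OneSketch.

Section Small.
Context {R : realType}.
Lemma near_small (a : nat -> R) (c eta : R) : a n @[n --> \oo] --> 0 -> 0 < eta ->
  \forall n \near \oo, c * a n <= eta.
Proof.
move=> a0 eta0; have ca : c * a n @[n --> \oo] --> (c * 0 : R).
  by apply: cvgM => //; exact: cvg_cst.
move: ca; rewrite mulr0 => /cvgrPdist_le/(_ _ eta0); apply: filterS => n.
by rewrite sub0r normrN => /(le_trans (ler_norm _)).
Qed.

Lemma cvg_sqrt0 (a : nat -> R) : a n @[n --> \oo] --> 0 ->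
  Num.sqrt (a n) @[n --> \oo] --> 0.
Proof.
move=> a0; rewrite -[X in _ --> X]sqrtr0.
by apply: cvg_comp a0 _; exact: sqrt_continuous.
Qed.

End Small.

Section Conditional.
Context {R : realType} (p : nat) (i : 'I_p.+1).
Context d (T : measurableType d) (P : probability T R).
Context (m : nat -> nat) (S : forall n, T -> 'M[R]_(m n, n)).
Hypothesis m_infty : m n @[n --> \oo] --> \oo.
Hypothesis S_random : forall n, random_matrix (S n).
Context (X U : forall n, 'M[R]_(n, p.+1)) (ell : nat -> 'rV[R]_p.+1) (V : nat -> 'M[R]_p.+1).
Hypothesis svd : \forall n \near \oo, is_svd (X n) (U n) (ell n) (V n).
Context (tau : nat -> R) (G : nat -> 'M[R]_(p.+1 * p.+1)).
Context (frakP : (forall n, 'M[R]_(n, p.+1)) -> Prop).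
Hypothesis condC : conditionsC m tau ell U frakP.
Hypothesis clt : sketch_clt P S tau U G.
Hypothesis sample_size :
  (m n)%:R * (n%:R * tau n * G n (vec_index i i) (vec_index i i))^-1 @[n --> \oo] --> (0 : R).
Context (Sigma : 'M[R]_p.+1).
Hypothesis Sigma_pd : posdefmx Sigma.

(** The statistic for one realization of the data. *)
Definition studentized n (w : T) : R :=
  let Lhat := sketched_eigval (S n w) (X n) i in
  Num.sqrt ((m n)%:R / (tau n * G n (vec_index i i) (vec_index i i)))
    * Lhat^-1 * (Lhat - lambda Sigma i).

Let E n w : 'M[R]_p.+1 := (U n)^T *m (S n w)^T *m S n w *m U n - 1%:M.
Let A n := tau n *: compress (G n).
Let W n w := Num.sqrt (m n)%:R *: (invsqrtmx (A n) *m ((@dup_mx R p.+1)^T *m vec (E n w))).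

Let measurable_W n k : measurable_fun setT (fun w => W n w k 0).
Proof.
have mE j l : measurable_fun setT (fun w => E n w j l).
  have mM : random_matrix (fun w => (U n)^T *m (S n w)^T *m S n w *m U n).
    apply: random_matrix_mul; last exact: random_matrix_cst.
    apply: random_matrix_mul => //; apply: random_matrix_mul; first exact: random_matrix_cst.
    exact: random_matrix_tr.
  under eq_fun do rewrite mxE; apply: measurable_funD; first exact: mM.
  exact: measurable_cst.
have mz : random_matrix (fun w => (@dup_mx R p.+1)^T *m vec (E n w)).
  by move=> b c; rewrite (ord1 c); under eq_fun do rewrite vechE; exact: mE.
under eq_fun do rewrite mxE; apply: measurable_funM => //.
by apply: (random_matrix_mul (random_matrix_cst _) mz).
Qed.

Lemma measurable_studentized n : measurable_fun setT (studentized n).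
Proof.
have mL : measurable_fun setT (fun w => sketched_eigval (S n w) (X n) i).
  apply: measurable_lambda => [|w]; last by rewrite !trmx_mul !trmxK !mulmxA.
  apply: random_matrix_mul; last exact: random_matrix_cst.
  apply: random_matrix_mul => //; apply: random_matrix_mul; first exact: random_matrix_cst.
  exact: random_matrix_tr.
apply: measurable_funM; last exact: measurable_funB.
by apply: measurable_funM => //; exact: measurable_funV_real.
Qed.

(** The event on the covariance error is a premise on [n] rather than a restriction
    of the sequence, so that the limit can later be integrated over data for which
    it fails infinitely often. *)
Theorem conditional_limit (K : R) (f : R -> R) (M eps : R) : 0 <= K ->
  continuous f -> (forall x, `|f x| <= M) -> 0 < eps ->
  \forall n \near \oo,
    (forall j k, `|((X n)^T *m X n) j k - Sigma j k| <= K / Num.sqrt n%:R) ->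
    `|\int[P]_w f (studentized n w) - \int[normal_prob 0 1]_x f x| <= eps.
Proof.
move=> K0 cf fM eps0.
have [[c0 [C0 [c0_gt0 cC G_bounds]]] W_law] := clt.
have C0_gt0 : 0 < C0 by rewrite (lt_trans c0_gt0).
have [bounded_ratio gap_ratio tau_pos tau_small _] := condC.
have [kap kapP] := limn_esup_bounded bounded_ratio.
have [r r1 rP] := limn_einf_gt1 gap_ratio.
have [b bE] := upper_index (leqnn i).
have lam_gt0 : 0 < lambda Sigma i := lambda_gt0 i Sigma_pd.
set lam := lambda Sigma i in lam_gt0 *.
have /choice[u uP] : forall n, exists u : 'rV[R]_(hdim p.+1), posdefmx (A n) ->
    \sum_k u 0 k ^+ 2 = 1 /\ forall z : 'cV[R]_(hdim p.+1),
      \sum_k u 0 k * (invsqrtmx (A n) *m z) k 0 = z b 0 / Num.sqrt (A n b b).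
  move=> n; have [posA|nposA] := pselect (posdefmx (A n)); last by exists 0.
  by have [u uA] := invsqrt_standardize b posA; exists u.
have m_pos : \forall n \near \oo, (0 < m n)%N by move/cvgnyPgt : m_infty; exact.
have posA : \forall n \near \oo, posdefmx (A n).
  by apply: filterS2 tau_pos G_bounds => n tau_n [[_ _ Gpos] _ _]; exact: posdefZ.
(* for the [n] with a large covariance error, [Y] is the linear form itself *)
pose F n := `[< forall j k, `|((X n)^T *m X n) j k - Sigma j k| <= K / Num.sqrt n%:R >].
pose Y n w := if F n then studentized n w else linform (u n) (W n w).
have mY n : measurable_fun setT (Y n).
  rewrite /Y; case: (F n); first exact: measurable_studentized.
  exact: measurable_linform.
have unit_u : \forall n \near \oo, \sum_k u n 0 k ^+ 2 = 1.
  by apply: filterS posA => n posAn; have [] := uP n posAn.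
suff Ycvg : \int[P]_w f (Y n w) @[n --> \oo] --> \int[normal_prob 0 1]_x f x.
  have /cvgrPdist_le/(_ _ eps0) := Ycvg; apply: filterS => n; rewrite distrC /Y /F.
  by case: asboolP.
apply: (@slutsky_linform R d T P _ W measurable_W W_law u Y mY unit_u _ f M cf fM).
move=> K' eta eta0.
pose t n := Num.sqrt (tau n / (m n)%:R).
have t0 : t n @[n --> \oo] --> 0 by exact: cvg_sqrt0.
pose a n := Num.sqrt ((m n)%:R * (n%:R * tau n * G n (vec_index i i) (vec_index i i))^-1).
have a0 : a n @[n --> \oo] --> 0 by exact: cvg_sqrt0.
pose g := 1 - r^-2.
have g0 : 0 < g by rewrite subr_gt0 invf_lt1 ?exprn_egt1 ?exprn_gt0 // (lt_trans ltr01).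
(* [e n] bounds the entries of [E n w] whenever [l1norm (W n w) <= K'] *)
pose K1 := Num.max K' 0.
have K10 : 0 <= K1 by rewrite le_max lexx orbT.
pose C := 2 * p.+1%:R ^+ 2 * (Num.max kap 0) ^+ 3 / g.
have kap0 : 0 <= Num.max kap 0 by rewrite le_max lexx orbT.
have C_ge0 : 0 <= C by rewrite divr_ge0 ?mulr_ge0 ?exprn_ge0 // ltW.
pose e n := Num.sqrt C0 * t n * K1.
have e_small (c : R) : 0 < c -> \forall n \near \oo, e n <= c.
  move=> c1; have := near_small (Num.sqrt C0 * K1) t0 c1; apply: filterS => n.
  by rewrite /e mulrAC.
have eta2 : 0 < eta / 4 by rewrite divr_gt0.
have kk : 0 < 4 * (p.+1%:R * (Num.max kap 0) ^+ 2) + 1 :> R.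
  by rewrite ltr_wpDl // !mulr_ge0 ?exprn_ge0.
have C1 : 0 < 2 * (1 + C) by rewrite mulr_gt0 // ltr_wpDr.
have sqc0 : 0 < Num.sqrt c0 by rewrite sqrtr_gt0.
have near_svd : \forall n \near \oo,
    (forall j, ell n 0 j <= kap * ell n 0 i) /\
    (forall j, j != i -> g * ell n 0 i ^+ 2 <= `|ell n 0 i ^+ 2 - ell n 0 j ^+ 2|).
  apply: filterS3 svd kapP rP => n [_ _ _ noninc pos] kn rn.
  exact: singular_value_gap.
have near_size : \forall n \near \oo, p.+1%:R * (K / Num.sqrt n%:R) <= lam / 2.
  near=> n; set B := 2 * p.+1%:R * K / lam + 1.
  have B0 : 0 < B by rewrite ltr_wpDl // divr_ge0 ?mulr_ge0 // ltW.
  have Bn : B ^+ 2 <= n%:R by near: n; exact: nbhs_infty_ger.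
  have Bs : B <= Num.sqrt n%:R.
    by rewrite -[leLHS]ger0_norm ?(ltW B0) // -sqrtr_sqr ler_wsqrtr.
  rewrite mulrA ler_pdivrMr; last by rewrite (lt_le_trans B0).
  apply: le_trans (ler_wpM2l _ Bs); last by rewrite divr_ge0 // ltW.
  rewrite /B mulrDr mulr1 (_ : lam / 2 * (2 * p.+1%:R * K / lam) = p.+1%:R * K).
    by rewrite lerDl divr_ge0 // ltW.
  by field; rewrite gt_eqF.
have near_a : \forall n \near \oo, 4 * p.+1%:R * K / lam * a n <= eta / 2.
  by apply: near_small a0 _; rewrite divr_gt0.
have near_t : \forall n \near \oo,
    2 * (2 * C + 1) * (C0 * K1 ^+ 2 / Num.sqrt c0) * t n <= eta / 2.
  by apply: near_small t0 _; rewrite divr_gt0.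
have near_e1 : \forall n \near \oo, e n <= 1 by exact: e_small.
have near_e2 : \forall n \near \oo, e n <= (2 * (1 + C))^-1.
  by apply: e_small; rewrite invr_gt0.
have near_e3 : \forall n \near \oo, e n <= g / (4 * (p.+1%:R * (Num.max kap 0) ^+ 2) + 1).
  by apply: e_small; rewrite divr_gt0.
near=> n => w wK.
rewrite /Y /F; case: asboolP => [Fn|_]; last by rewrite subrr normr0 ltW.
have svd_n : is_svd (X n) (U n) (ell n) (V n) by near: n.
have [ell_kap ell_gap] : (forall j, ell n 0 j <= kap * ell n 0 i) /\
    (forall j, j != i -> g * ell n 0 i ^+ 2 <= `|ell n 0 i ^+ 2 - ell n 0 j ^+ 2|).
  by near: n.
have [GS cG GC] : [/\ absolutely_symmetric (G n),
      loewner_le (c0%:M) (compress (G n)) & loewner_le (compress (G n)) (C0%:M)] by near: n.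
have tau_n : 0 < tau n by near: n.
have m_n : (0 < m n)%N by near: n.
have posA_n : posdefmx (A n) by near: n.
have n_n : (0 < n)%N by near: n; exact: nbhs_infty_gt.
have mR : 0 < (m n)%:R :> R by rewrite ltr0n.
have nR : 0 < n%:R :> R by rewrite ltr0n.
have [_ _ _ noninc pos] := svd_n.
have symE : (E n w)^T = E n w.
  by rewrite /E linearB /= trmx1 !trmx_mul !trmxK !mulmxA.
have en0 : 0 <= e n by rewrite /e !mulr_ge0 ?sqrtr_ge0.
have Ee j k : `|E n w j k| <= e n.
  have := standardized_bound m_n tau_n posA_n (ltW C0_gt0) GC symE j k.
  move=> /le_trans; apply; rewrite ler_wpM2l ?mulr_ge0 ?sqrtr_ge0 //.
  by rewrite (le_trans wK) // le_max lexx.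
set Gii := G n (vec_index i i) (vec_index i i).
have GiiE : compress (G n) b b = Gii by rewrite compress_diag bE.
have c0G : c0 <= Gii by have := loewner_diag b cG; rewrite GiiE mxE eqxx mulr1n.
have Gii0 : 0 < Gii by rewrite (lt_le_trans c0_gt0).
set s := Num.sqrt ((m n)%:R / (tau n * Gii)).
have -> : linform (u n) (W n w) = s * E n w i i.
  have [_ up] := uP n posA_n; exact: (standardized_linform (m n) (E n w) tau_n bE posA_n up).
have kmax j : ell n 0 j <= Num.max kap 0 * ell n 0 i.
  by rewrite (le_trans (ell_kap j)) // ler_wpM2r ?(ltW (pos _)) // le_max lexx.
have e3 : e n <= g / (4 * (p.+1%:R * (Num.max kap 0) ^+ 2) + 1) by near: n.
have pert := @perturbation R _ (ell n) (E n w) i (Num.max kap 0) g (e n) symE pos noninc kmax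
  ell_gap Ee g0.
have small3 : 4 * (p.+1%:R * Num.max kap 0 ^+ 2 * e n) <= g.
  move: e3; rewrite ler_pdivlMr // => /(le_trans _); apply.
  by rewrite mulrDr mulr1 -[leLHS]addr0 lerD // le_eqVlt; apply/orP; left; apply/eqP; ring.
have {}pert := pert small3; rewrite -(sketched_eigvalE (S n w) i svd_n) -/C in pert.
have L0 : 0 < ell n 0 i ^+ 2 by rewrite exprn_gt0.
set L := ell n 0 i ^+ 2 in L0 pert *.
have symX : ((X n)^T *m X n)^T = (X n)^T *m X n by rewrite trmx_mul trmxK.
have Lr : `|L - lam| <= p.+1%:R * (K / Num.sqrt n%:R).
  by rewrite /L -(gram_eigval i svd_n); apply: weyl => //; case: Sigma_pd.
have Llam : lam / 2 <= L.
  have sz : p.+1%:R * (K / Num.sqrt n%:R) <= lam / 2 by near: n.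
  by move: (le_trans Lr sz) => /ler_normlP[? ?]; lra.
have e1 : e n <= 1 by near: n.
have e2 : e n + C * e n ^+ 2 <= 1 / 2.
  have e2 : e n <= (2 * (1 + C))^-1 by near: n.
  have h : e n * (2 * (1 + C)) <= 1 by rewrite -ler_pdivlMr // mul1r.
  have h2 : C * e n ^+ 2 <= C * e n.
    by rewrite ler_wpM2l // expr2 ler_piMl.
  by lra.
have := relative_error L0 (sqrtr_ge0 _ : 0 <= s) pert (Ee i i) Lr C_ge0 en0 e1 e2.
rewrite /studentized -/Gii -/s -/lam => /le_trans; apply.
have h1 : s * (p.+1%:R * (K / Num.sqrt n%:R)) / L <= 2 * p.+1%:R * K / lam * a n.
  have -> : a n = s / Num.sqrt n%:R.
    rewrite /a /s -[in RHS]sqrtrV ?ltW // -sqrtrM ?divr_ge0 ?mulr_ge0 ?(ltW mR) ?(ltW tau_n) ?(ltW Gii0) //.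
    by congr Num.sqrt; rewrite -/Gii; field; rewrite !gt_eqF.
  have -> : 2 * p.+1%:R * K / lam * (s / Num.sqrt n%:R) =
      s * (p.+1%:R * (K / Num.sqrt n%:R)) * (lam / 2)^-1.
    by rewrite invfM invrK; ring.
  apply: ler_wpM2l; first by rewrite !mulr_ge0 ?invr_ge0 ?sqrtr_ge0.
  by rewrite lef_pV2 ?posrE // divr_gt0.
have t_gt0 : 0 < t n by rewrite sqrtr_gt0 divr_gt0.
have h2 : s * e n ^+ 2 <= C0 * K1 ^+ 2 / Num.sqrt c0 * t n.
  have st : s <= (Num.sqrt c0 * t n)^-1.
    rewrite /t -sqrtrM ?(ltW c0_gt0) // -sqrtrV ?mulr_ge0 ?divr_ge0 ?(ltW c0_gt0) ?(ltW tau_n) ?(ltW mR) //.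
    rewrite ler_wsqrtr // (_ : (c0 * (tau n / (m n)%:R))^-1 = (m n)%:R / (tau n * c0)).
      by rewrite ler_pM2l // lef_pV2 ?posrE ?mulr_gt0 // ler_pM2l.
    by field; rewrite !gt_eqF.
  have -> : e n ^+ 2 = C0 * t n ^+ 2 * K1 ^+ 2.
    by rewrite /e !exprMn sqr_sqrtr // ltW.
  have -> : C0 * K1 ^+ 2 / Num.sqrt c0 * t n =
      (Num.sqrt c0 * t n)^-1 * (C0 * t n ^+ 2 * K1 ^+ 2).
    by field; rewrite !gt_eqF.
  by rewrite ler_wpM2r // !mulr_ge0 ?exprn_ge0 ?(ltW C0_gt0) ?(ltW t_gt0).
have na : 4 * p.+1%:R * K / lam * a n <= eta / 2 by near: n.
have nt : 2 * (2 * C + 1) * (C0 * K1 ^+ 2 / Num.sqrt c0) * t n <= eta / 2 by near: n.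
have h3 : (2 * C + 1) * (s * e n ^+ 2) <= (2 * C + 1) * (C0 * K1 ^+ 2 / Num.sqrt c0 * t n).
  by rewrite ler_wpM2l // addr_ge0 // mulr_ge0.
have -> : eta = eta / 2 + eta / 2 by rewrite -splitr.
rewrite mulrDr lerD //.
  by apply: le_trans na; move: h1; set x := s * _ / _; set y := a n => h1; lra.
by apply: le_trans nt; move: h3; set x := (2 * C + 1) * _; set y := t n => h3; lra.
Unshelve. all: by end_near. Qed.

End Conditional.

(** * Integration over the data *)

(** Almost sure convergence is needed only off sets of small probability, which may
    depend on [n]. *)
Lemma cvg_mix {R : realType} d1 (T1 : measurableType d1) (P1 : probability T1 R)
    (phi : nat -> T1 -> R) (c M : R) :
  (forall n, measurable_fun setT (phi n)) -> (forall n w, `|phi n w| <= M) -> `|c| <= M ->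
  (forall e : R, 0 < e -> exists2 bad : nat -> set T1,
     \forall n \near \oo, measurable (bad n) /\ (P1 (bad n) <= e%:E)%E &
     {ae P1, forall w, forall eps, 0 < eps -> \forall n \near \oo,
        ~ bad n w -> `|phi n w - c| <= eps}) ->
  \int[P1]_w phi n w @[n --> \oo] --> c.
Proof.
move=> mphi phiM cM H; have M0 : 0 <= M by exact: le_trans cM.
apply/cvgrPdist_le => eps eps0.
pose e := eps / 2 / (1 + 2 * M).
have d0 : 0 < 1 + 2 * M by rewrite ltr_wpDr // mulr_ge0.
have e0 : 0 < e by rewrite !divr_gt0.
have [bad badP badcvg] := H e e0.
(* replacing [phi] by its limit on the bad set changes the integral by [O(e)]
   and makes dominated convergence applicable *)
pose chi n w := if `[< measurable (bad n) /\ ~ bad n w >] then phi n w else c.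
have mchi n : measurable_fun setT (chi n).
  have [mb|nmb] := pselect (measurable (bad n)); last first.
    rewrite (_ : chi n = cst c) //; apply/funext => w; rewrite /chi.
    by case: asboolP => // -[].
  rewrite (_ : chi n = fun w => phi n w * \1_(~` bad n) w + c * \1_(bad n) w).
    by apply: measurable_funD; apply: measurable_funM => //; apply: measurable_indic => //;
      exact: measurableC.
  apply/funext => w; rewrite /chi !indicE in_setC; case: asboolP => [[_ nb]|nb].
    by rewrite memNset // mulr1 mulr0 addr0.
  by rewrite mem_set ?mulr0 ?mulr1 ?add0r //; apply: contrapT => bw; exact: nb.
have chiM n w : `|chi n w| <= M by rewrite /chi; case: asboolP.
have chi_cvg : \int[P1]_w chi n w @[n --> \oo] --> c.
  have [|||||_ _] := @dominated_convergence _ _ _ P1 setT measurableT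
    (fun n w => (chi n w)%:E) (cst c%:E) (cst M%:E).
  - by move=> n; exact/measurable_EFinP.
  - exact: measurable_cst.
  - apply: filterS badcvg => w bw _; apply: cvg_EFin; first exact: nearW.
    apply/cvgrPdist_le => eta eta0; apply: filterS (bw eta eta0) => n bn.
    rewrite distrC /= /chi; case: asboolP => [[_ nb]|_]; first exact: bn.
    by rewrite subrr normr0 ltW.
  - exact: finite_measure_integrable_cst.
  - by apply: aeW => w n _ /=; rewrite lee_fin.
  have -> : (\int[P1]_(x in setT) cst c%:E x = c%:E)%E by exact: integral_prob_cst.
  by move=> /fine_cvg.
have /cvgrPdist_le/(_ (eps / 2)) := chi_cvg; rewrite divr_gt0 // => /(_ isT) chi_near.
near=> n.
have [mbad Pbad] : measurable (bad n) /\ (P1 (bad n) <= e%:E)%E by near: n.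
have chi_n : `|c - \int[P1]_w chi n w| <= eps / 2 by near: n.
rewrite [leRHS]splitr (le_trans (ler_distD (\int[P1]_w chi n w) _ _)) // lerD //.
have -> : eps / 2 = e + 2 * M * e by rewrite /e; field; rewrite gt_eqF.
apply: (expectation_close (mchi n) (mphi n) (chiM n) (phiM n) mbad Pbad) => w nbw.
rewrite /chi; case: asboolP => [_|[]]; last by split.
by rewrite subrr normr0 ltW.
Unshelve. all: by end_near. Qed.

Theorem mainTheorem4 (R : realType) (p : nat)
  (* data space and sketching space: the sketches are independent of the data *)
  (d1 : measure_display) (T1 : measurableType d1) (P1 : probability T1 R)
  (d2 : measure_display) (T2 : measurableType d2) (P2 : probability T2 R)
  (* population *)
  (mu : probability (p.+1.-tuple R) R) (Sigma : 'M[R]_p.+1)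
  (mu_centered : forall j : 'I_p.+1, ('E_mu[coordinate j] = 0)%E)
  (mu_cumulant : finite_fourth_cumulant mu)
  (SigmaE : Sigma = cov_mx mu) (Sigma_pd : posdefmx Sigma)
  (* data: X_n = n^{-1/2} Z_n, the rows of Z_n being a sample from mu *)
  (Z X : forall n, T1 -> 'M[R]_(n, p.+1))
  (Z_iid : forall n, iid_rows P1 mu (Z n))
  (XE : forall n w, X n w = (Num.sqrt n%:R)^-1 *: Z n w)
  (* sketches *)
  (m : nat -> nat) (m_infty : m n @[n --> \oo] --> \oo)
  (m_lt : \forall n \near \oo, (m n < n)%N)
  (S : forall n, T2 -> 'M[R]_(m n, n))
  (S_random : forall n, random_matrix (S n))
  (* singular value decompositions *)
  (U : forall n, T1 -> 'M[R]_(n, p.+1)) (ell : nat -> T1 -> 'rV[R]_p.+1)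
  (V : nat -> T1 -> 'M[R]_p.+1)
  (svd : {ae P1, forall w, \forall n \near \oo,
     is_svd (X n w) (U n w) (ell n w) (V n w)})
  (* conditions (C), given the data *)
  (tau : nat -> T1 -> R) (tau_random : forall n, measurable_fun setT (tau n))
  (G : nat -> T1 -> 'M[R]_(p.+1 * p.+1)) (G_random : forall n, random_matrix (G n))
  (frakP : (forall n, 'M[R]_(n, p.+1)) -> Prop)
  (frakP_clt : forall w, frakP (fun n => U n w) ->
     sketch_clt P2 S (tau ^~ w) (fun n => U n w) (G ^~ w))
  (condC : {ae P1, forall w,
     conditionsC m (tau ^~ w) (ell ^~ w) (fun n => U n w) frakP})
  (i : 'I_p.+1)
  (sample_size : {ae P1, forall w,
     (m n)%:R * (n%:R * tau n w * G n w (vec_index i i) (vec_index i i))^-1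
       @[n --> \oo] --> (0 : R)}) :
  cvg_in_law (P1 \x P2)%E (normal_prob 0 1)
    (fun n (w : T1 * T2) =>
       let Lhat := sketched_eigval (S n w.2) (X n w.1) i in
       Num.sqrt ((m n)%:R / (tau n w.1 * G n w.1 (vec_index i i) (vec_index i i)))
         * Lhat^-1 * (Lhat - lambda Sigma i))
    (id : R -> R).
Proof.
move=> f cf [M fM].
have mf : measurable_fun setT f by exact: continuous_measurable_fun.
have M0 : 0 <= M by rewrite (le_trans _ (fM 0)).
pose Y n (w : T1 * T2) : R := studentized i S (fun n => X n w.1) (tau ^~ w.1) (G ^~ w.1) Sigma n w.2.
have mX n : random_matrix (X n).
  have [mZ _ _] := Z_iid n; move=> j k; under eq_fun do rewrite XE mxE.
  by apply: measurable_funM => //; exact: mZ.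
have mY n : measurable_fun setT (Y n).
  have mX1 : random_matrix (fun w : T1 * T2 => X n w.1).
    by apply: random_matrix_comp (mX n); exact: measurable_fst.
  have mS2 : random_matrix (fun w : T1 * T2 => S n w.2).
    by apply: random_matrix_comp (S_random n); exact: measurable_snd.
  have mL : measurable_fun setT (fun w : T1 * T2 => sketched_eigval (S n w.2) (X n w.1) i).
    apply: measurable_lambda => [|w]; last by rewrite !trmx_mul !trmxK !mulmxA.
    exact: (random_matrix_mul (random_matrix_mul
      (random_matrix_mul (random_matrix_tr mX1) (random_matrix_tr mS2)) mS2) mX1).
  have mtau : measurable_fun setT (fun w : T1 * T2 => tau n w.1).
    by apply: measurableT_comp (tau_random n) _; exact: measurable_fst.
  have mG : measurable_fun setT (fun w : T1 * T2 => G n w.1 (vec_index i i) (vec_index i i)).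
    by apply: measurableT_comp (G_random n _ _) _; exact: measurable_fst.
  apply: measurable_funM; last exact: measurable_funB.
  apply: measurable_funM; last exact: measurable_funV_real.
  apply: measurableT_comp; first by apply: continuous_measurable_fun; exact: sqrt_continuous.
  by apply: measurable_funM => //; apply: measurable_funV_real; exact: measurable_funM.
have mfY n : measurable_fun setT (fun w => f (Y n w)) by exact: measurableT_comp.
pose phi n w1 := \int[P2]_w2 f (Y n (w1, w2)).
have section_meas n w1 : measurable_fun setT (fun w2 => f (Y n (w1, w2))).
  exact: measurableT_comp (mfY n) (pair1_measurable w1).
have phi_fin n w1 : (\int[P2]_w2 (f (Y n (w1, w2)))%:E)%E = (phi n w1)%:E.
  rewrite /phi /Rintegral fineK //; apply: integrable_fin_num => //.
  exact: (bounded_integrable P2 (section_meas n w1) (fun w2 => fM _)).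
have ifY n : (P1 \x P2)%E.-integrable setT (EFin \o (fun w => f (Y n w))).
  exact: (bounded_integrable (P1 \x P2)%E (mfY n) (fun w => fM _)).
have mphi n : measurable_fun setT (phi n).
  apply/measurable_EFinP; rewrite (_ : _ \o _ = fubini_F P2 (EFin \o (fun w => f (Y n w)))).
    exact: measurable_fubini_F.
  by apply/funext => w1; rewrite /fubini_F /= phi_fin.
have phiM n w1 : `|phi n w1| <= M.
  exact: (Rintegral_bound P2 (section_meas n w1) (fun w2 => fM _)).
have EY n : ('E_(P1 \x P2)[f \o Y n] = (\int[P1]_w1 phi n w1)%:E)%E.
  rewrite unlock -[LHS](integral12_prod_meas1 (ifY n)) /Rintegral fineK.
    by apply: eq_integral => w1 _; rewrite /fubini_F /= phi_fin.
  by apply: integrable_fin_num => //; exact: (bounded_integrable P1 (mphi n) (phiM n)).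
have EN : ('E_(normal_prob 0 1)[f \o id] = (\int[normal_prob 0 1]_x f x)%:E)%E.
  exact: (expectation_Rintegral (normal_prob 0 1) mf fM).
rewrite EN; under eq_fun do rewrite -/(Y _) EY.
apply: cvg_EFin; first exact: nearW.
apply: (@cvg_mix _ _ _ _ _ _ M) => //.
  exact: (Rintegral_bound (normal_prob 0 1) mf fM).
move=> e e0; have [W W0 rate] := sample_covariance_rate mu_centered mu_cumulant P1.
(* chosen so that the covariance error exceeds [K / sqrt n] with probability at
   most [W / K ^+ 2 <= e] *)
pose K := Num.sqrt ((W + 1) / e).
have W1 : 0 < W + 1 by rewrite ltr_wpDl.
have K0 : 0 < K by rewrite sqrtr_gt0 divr_gt0.
exists (fun n => [set w | K ^+ 2 / n%:R < cov_error mu (X n w)]).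
  near=> n.
  have n0 : (0 < n)%N by near: n; exact: nbhs_infty_gt.
  split.
    rewrite -[X in measurable X]setTI; apply: measurable_fun_ltr => //.
    exact: measurable_cov_error.
  have -> : [set w | K ^+ 2 / n%:R < cov_error mu (X n w)] =
      [set w | K ^+ 2 / n%:R < cov_error mu ((Num.sqrt n%:R)^-1 *: Z n w)].
    by apply/funext => w /=; rewrite XE.
  apply: le_trans (rate n (Z n) n0 (Z_iid n) K K0) _; rewrite lee_fin.
  rewrite /K sqr_sqrtr ?divr_ge0 ?(ltW e0) ?(ltW W1) // invf_div mulrCA ger_pMr //.
  by rewrite ler_pdivrMr // mul1r lerDl.
apply: filterS3 svd condC sample_size => w svdw condw sizew eps eps0.
have [_ _ _ _ /frakP_clt clt] := condw.
have := conditional_limit (i := i) m_infty S_random svdw condw clt sizew Sigma_pd (ltW K0) cf fM eps0.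
apply: filterS2 (nbhs_infty_gt 0) => n n0 H nbad; apply: H => j k.
rewrite SigmaE; apply: (@cov_error_entry _ _ mu).
  by rewrite divr_ge0 ?sqrtr_ge0 ?(ltW K0).
rewrite exprMn exprVn [Num.sqrt n%:R ^+ 2]sqr_sqrtr ?ler0n //.
by move/negP: nbad; rewrite -leNgt.
Unshelve. all: by end_near. Qed.
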